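(* Let $\mathcal{H}$ be a Krein space, $W\in L(\mathcal{H})^{[s]}$ and let $\mathcal{S}$ be a closed subspace of $\mathcal{H}$. Suppose that, for some signature operator $J$, $\mathcal{S}=\mathcal{S}_+[\dotplus]_W\mathcal{S}_-$ is any decomposition with $\mathcal{S}_\pm$ closed, $\mathcal{S}_+$ $W$-nonnegative, $\mathcal{S}_-$ $W$-nonpositive and $\mathcal{S}_+\perp\mathcal{S}_-$ in the Hilbert space associated with $J$. Then $W$ is $\mathcal{S}$-weakly complementable if and only if there exist $\min\mathcal{N}^{+}(\max\mathcal{N}^{-}(W,\mathcal{S}_+^{[\perp]}),\mathcal{S}_-^{[\perp]})$ and $\max\mathcal{N}^{-}(\min\mathcal{N}^{+}(W,\mathcal{S}_-^{[\perp]}),\mathcal{S}_+^{[\perp]})$. In this case, $$W_{/[\mathcal{S}]}=\min\mathcal{N}^{+}(\max\mathcal{N}^{-}(W,\mathcal{S}_+^{[\perp]}),\mathcal{S}_-^{[\perp]})=\max\mathcal{N}^{-}(\min\mathcal{N}^{+}(W,\mathcal{S}_-^{[\perp]}),\mathcal{S}_+^{[\perp]}).$$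
   Context: Hilbert spaces are complex and separable. A Krein space $(\mathcal{H},[\,\cdot,\cdot\,])$ is a linear space with a sesquilinear Hermitian form admitting a fundamental decomposition $\mathcal{H}=\mathcal{H}_+[\dotplus]\mathcal{H}_-$, an $[\,\cdot,\cdot\,]$-orthogonal direct sum in which $(\mathcal{H}_+,[\,\cdot,\cdot\,])$ and $(\mathcal{H}_-,-[\,\cdot,\cdot\,])$ are Hilbert spaces. The associated signature operator is $J=P_+-P_-$, where $P_\pm$ is the projection onto $\mathcal{H}_\pm$ with nullspace $\mathcal{H}_\mp$; it yields the Hilbert space inner product $\langle x,y\rangle=[Jx,y]$. All Hilbert norms arising this way are equivalent; $L(\mathcal{H})$ is the set of operators bounded for them. $T^{\#}$ denotes the Krein space adjoint, $[Tx,y]=[x,T^{\#}y]$, and $L(\mathcal{H})^{[s]}=\{T\in L(\mathcal{H}):T=T^{\#}\}$. For $S,T\in L(\mathcal{H})^{[s]}$, $S\leq T$ means $[(T-S)x,x]\ge0$ for all $x$. $\mathcal{S}^{[\perp]}=\{x:[x,s]=0\ \forall s\in\mathcal{S}\}$. $\mathcal{S}$ is $W$-nonnegative (resp. $W$-nonpositive) if $[Ws,s]\ge0$ (resp. $\le0$) for all $s\in\mathcal{S}$. $\mathcal{S}_+[\dotplus]_W\mathcal{S}_-$ denotes the direct sum of $\mathcal S_+$ and $\mathcal S_-$ when additionally $[Ws,t]=0$ for all $s\in\mathcal{S}_+$, $t\in\mathcal{S}_-$. Hilbert space notions: let $B$ be a bounded selfadjoint operator on a Hilbert space with block form $B=\begin{pmatrix}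 a & b\\ b^* & c\end{pmatrix}$ with respect to $\mathcal{S}\oplus\mathcal{S}^\perp$. $B$ is $\mathcal{S}$-weakly complementable if $R(b)\subseteq R(|a|^{1/2})$. In that case let $f$ be the reduced solution of $b=|a|^{1/2}x$, i.e. the unique bounded $f:\mathcal{S}^\perp\to\mathcal{S}$ with $b=|a|^{1/2}f$, $N(f)=N(b)$, $R(f)\subseteq\overline{R(|a|^{1/2})}$, and let $a=u|a|$ be the polar decomposition ($N(u)=N(a)$). The Schur complement is $B_{/\mathcal{S}}:=\begin{pmatrix}0&0\\0&c-f^*uf\end{pmatrix}$. ($R$, $N$ denote range and nullspace.) Krein space notions: $W$ is $\mathcal{S}$-weakly complementable if $JW$ is $\mathcal{S}$-weakly complementable in the Hilbert space associated with some signature operator $J$ of $\mathcal H$, and then $W_{/[\mathcal{S}]}:=J\,(JW)_{/\mathcal{S}}$; neither notion depends on the choice of $J$. For $V\in L(\mathcal{H})^{[s]}$ and a closed subspace $\mathcal{T}$, $\mathcal{N}^{-}(V,\mathcal{T}^{[\perp]}):=\{X\in L(\mathcal{H})^{[s]}:X\leq V,\ R(X)\subseteq\mathcal{T}^{[\perp]}\}$ and $\mathcal{N}^{+}(V,\mathcal{T}^{[\perp]}):=\{X\in L(\mathcal{H})^{[s]}:V\leq X,\ R(X)\subseteq\mathcal{T}^{[\perp]}\}$; $\max$/$\min$ are maximum/minimum elements with respect to $\leq$. Existence of a nested expression means that the inner extremum exists and then the outer one exists. *)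

(* Defs.v *)
From mathcomp Require Import all_boot all_order all_algebra.
From mathcomp Require Import complex.
From mathcomp Require Import all_classical all_reals.
From mathcomp Require Import topology normedtype sequences.

Set Implicit Arguments.
Unset Strict Implicit.
Unset Printing Implicit Defensive.

Import Order.TTheory GRing.Theory Num.Theory.
Import numFieldNormedType.Exports.

Local Open Scope classical_set_scope.
Local Open Scope ring_scope.

(* Operators are functions [H -> H] subject to explicit linearity and
   boundedness predicates.  Forms are linear in the first argument.  An order
   statement [0 <= z] with [z : R[i]] says that [z] is real and nonnegative. *)

Section LinearAlgebra.
Context {R : realType} {H : lmodType R[i]}.
Implicit Types (A B S : set H) (P T : H -> H).

Definition subspace S : Prop := GRing.submod_closed [in S].

Definition nullspace T : set H := T @^-1` [set 0].

Definition direct_sum A B S : Prop :=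
  [set a + b | a in A & b in B] = S /\ A `&` B = [set 0].

Definition projection_onto A B P : Prop :=
  [/\ linear P, P \o P = P, range P = A & nullspace P = B].

End LinearAlgebra.

(* Notions relative to a form [g], used when [g] is a Hilbert space inner
   product, possibly only on a subspace of [H]. *)
Section HilbertSpace.
Context {R : realType} {H : lmodType R[i]}.
Context (g : H -> H -> R[i]).
Implicit Types (A K S : set H) (P T Q a b c u f fs : H -> H).

Definition gnorm (x : H) : R := Num.sqrt (complex.Re (g x x)).

Definition gclosure A : set H :=
  [set x | forall e : R, 0 < e -> exists2 y, A y & gnorm (x - y) < e].

Definition gclosed A : Prop := gclosure A `<=` A.

Definition gcauchy (x : nat -> H) : Prop :=
  forall e : R, 0 < e -> exists N : nat,
    forall m n : nat, (N <= m)%N -> (N <= n)%N -> gnorm (x m - x n) < e.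

Definition gcomplete K : Prop :=
  forall x : nat -> H, (forall n, K (x n)) -> gcauchy x ->
    exists2 l, K l & gnorm (x n - l) @[n --> \oo] --> (0 : R).

Definition gseparable K : Prop :=
  exists D : set H, [/\ countable D, D `<=` K & K `<=` gclosure D].

(* No sesquilinearity is required here: it is part of the type of the Krein
   space form from which all [g] below are derived. *)
Definition hilbert_space_on K : Prop :=
  [/\ subspace K, (forall x, K x -> 0 <= g x x),
      (forall x, K x -> g x x = 0 -> x = 0), gcomplete K & gseparable K].

Definition orthogonal_to A B : Prop := forall x y, A x -> B y -> g x y = 0.

Definition orthocompl S : set H := [set x | forall s, S s -> g x s = 0].

Definition bounded_op T : Prop :=
  linear T /\ exists M : R, forall x, gnorm (T x) <= M * gnorm x.

Definition adjoint_of T Ts : Prop := forall x y, g (T x) y = g x (Ts y).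

Definition positive_op T : Prop :=
  bounded_op T /\ forall x, 0 <= g (T x) x.

Definition is_sqrt_op T Q : Prop := positive_op Q /\ Q \o Q = T.

(* Q = |T| = (T^* T)^{1/2} *)
Definition is_abs_op T Q : Prop :=
  exists2 Ts, adjoint_of T Ts & is_sqrt_op (Ts \o T) Q.

Definition partial_isometry T : Prop :=
  bounded_op T /\
  forall x, orthocompl (nullspace T) x -> gnorm (T x) = gnorm x.

(* T = u |T|, with |T| supplied as [Q]. *)
Definition polar_decomposition T Q u : Prop :=
  [/\ is_abs_op T Q, partial_isometry u, nullspace u = nullspace T
    & T = u \o Q].

(* The reduced solution of b = q x. *)
Definition reduced_solution q b f : Prop :=
  [/\ bounded_op f, b = q \o f, nullspace f = nullspace b
    & range f `<=` gclosure (range q)].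

(* Blocks of T with respect to S (+) S^perp, P being the orthogonal projection
   onto S.  An operator between two of the subspaces S, S^perp is represented
   by its extension by 0 on the orthogonal complement of its domain.  This
   leaves ranges unchanged and adds that complement to nullspaces, so the range
   and nullspace conditions below are those of the blocks themselves; moduli,
   square roots, polar decompositions and adjoints commute with the
   extension. *)
Definition block_a P T : H -> H := P \o T \o P.
Definition block_b P T : H -> H := P \o T \o (idfun \- P).
Definition block_c P T : H -> H := (idfun \- P) \o T \o (idfun \- P).

Definition orthogonal_projection S P : Prop :=
  projection_onto S (orthocompl S) P.

Definition weakly_complementable T S : Prop :=
  exists P absa q,
    [/\ orthogonal_projection S P, is_abs_op (block_a P T) absa,
        is_sqrt_op absa q & range (block_b P T) `<=` range q].

(* Z = T_{/S}, i.e. Z = c - f^* u f on S^perp and 0 on S. *)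
Definition is_schur_complement T S Z : Prop :=
  weakly_complementable T S /\
  exists P absa q u f fs,
    [/\ orthogonal_projection S P,
        polar_decomposition (block_a P T) absa u /\ is_sqrt_op absa q,
        reduced_solution q (block_b P T) f,
        adjoint_of f fs
      & Z = block_c P T \- (fs \o u \o f)].

End HilbertSpace.

Section KreinSpace.
Context {R : realType} {H : lmodType R[i]}.
Context (ip : {hermitian_sym H for Num.conj}).
Implicit Types (A S Sp Sm M : set H) (J T V W X Y Z : H -> H).

Definition fundamental_decomposition (Hp Hm : set H) : Prop :=
  [/\ direct_sum Hp Hm setT, orthogonal_to ip Hp Hm,
      hilbert_space_on ip Hp & hilbert_space_on (fun x y => - ip x y) Hm].

Definition krein_space : Prop :=
  exists Hp Hm, fundamental_decomposition Hp Hm.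

Definition is_signature J : Prop :=
  exists Hp Hm Pp Pm,
    [/\ fundamental_decomposition Hp Hm, projection_onto Hp Hm Pp,
        projection_onto Hm Hp Pm & J = Pp \- Pm].

Definition hilbert_ip J : H -> H -> R[i] := fun x y => ip (J x) y.

(* All the Hilbert norms given by signature operators are equivalent, so that
   quantifying universally over [J] here and in [krein_closed_subspace] is only
   a way of not singling one out. *)
Definition krein_bounded T : Prop :=
  linear T /\ forall J, is_signature J -> bounded_op (hilbert_ip J) T.

Definition krein_closed_subspace S : Prop :=
  subspace S /\ forall J, is_signature J -> gclosed (hilbert_ip J) S.

Definition krein_selfadjoint T : Prop :=
  krein_bounded T /\ adjoint_of ip T T.

Definition krein_le T V : Prop := forall x, 0 <= ip ((V \- T) x) x.

Definition W_nonnegative W S : Prop := forall s, S s -> 0 <= ip (W s) s.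
Definition W_nonpositive W S : Prop := forall s, S s -> ip (W s) s <= 0.

Definition W_orthogonal_direct_sum W Sp Sm S : Prop :=
  direct_sum Sp Sm S /\ forall s t, Sp s -> Sm t -> ip (W s) t = 0.

Definition krein_weakly_complementable W S : Prop :=
  exists2 J, is_signature J &
    weakly_complementable (hilbert_ip J) (J \o W) S.

(* Z = W_{/[S]} *)
Definition is_krein_schur_complement W S Z : Prop :=
  exists2 J, is_signature J &
    exists2 B, is_schur_complement (hilbert_ip J) (J \o W) S B & Z = J \o B.

(* N^-(V, M) and N^+(V, M), used with M of the form T^[perp]. *)
Definition Nminus V M : set (H -> H) :=
  [set X | [/\ krein_selfadjoint X, krein_le X V & range X `<=` M]].
Definition Nplus V M : set (H -> H) :=
  [set X | [/\ krein_selfadjoint X, krein_le V X & range X `<=` M]].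

Definition is_max (N : set (H -> H)) X : Prop :=
  N X /\ forall Y, N Y -> krein_le Y X.
Definition is_min (N : set (H -> H)) X : Prop :=
  N X /\ forall Y, N Y -> krein_le X Y.

(* Z = min N^+(max N^-(W, S_+^[perp]), S_-^[perp]) *)
Definition is_min_max W Sp Sm Z : Prop :=
  exists2 Y, is_max (Nminus W (orthocompl ip Sp)) Y &
    is_min (Nplus Y (orthocompl ip Sm)) Z.

(* Z = max N^-(min N^+(W, S_-^[perp]), S_+^[perp]) *)
Definition is_max_min W Sp Sm Z : Prop :=
  exists2 Y, is_min (Nplus W (orthocompl ip Sm)) Y &
    is_max (Nminus Y (orthocompl ip Sp)) Z.

End KreinSpace.

(* Main.v *)
(* For [J] the given signature operator, the modulus of the compression of [J W]
   to [S] is [P J W (P_+ - P_-)], with [P], [P_+], [P_-] the orthogonal projections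
   onto [S], [S_+], [S_-]; let [q] be its square root.  Then [|q s|^2 = +/- [W s, s]]
   on [S_+/-], and [S]-weak complementability says that every functional
   [s |-> [W s, y]] on [S] is bounded with respect to [|q s|], hence of the form
   [<q s, f y>].  It passes to [S_+] and [S_-], giving maps [f_+], [f_-], and
   [max N^-(W, S_+^perp) = W - J f_+^* f_+], because [X <= W] with range in
   [S_+^perp] forces [[X y, y] <= [W (y - s), y - s]] for all [s] in [S_+].  Since
   [f_+ = 0] on [S_-] and [f_- = 0] on [S_+], both nested extrema equal
   [W - J f_+^* f_+ + J f_-^* f_-].  Conversely, if [N^-(W, S_+^perp)] contains
   some [X], Cauchy-Schwarz for [W - X >= 0] yields the boundedness on [S_+].

   Schur complements [Z] are compared through the property that for every [y],
   [z] and [e > 0] some [s] in [S] satisfies [|[W (y - s), t]| <= e |q t|] for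
   [t] in [S] and [|[Z y, z] - [W (y - s), z]| <= e].  It determines [Z], and it
   holds for the Schur complement formed with any other signature operator [J']:
   the modulus form of [J'] is bounded by a multiple of [|q s|^2] by Reid's
   inequality for symmetrizable operators. *)
Require Import Defs.
From mathcomp Require Import all_boot all_order all_algebra.
From mathcomp Require Import complex.
From mathcomp Require Import all_classical all_reals.
From mathcomp Require Import topology normedtype.
From mathcomp Require Import ring lra.

Set Implicit Arguments.
Unset Strict Implicit.
Unset Printing Implicit Defensive.

Import Order.TTheory GRing.Theory Num.Theory.
Import numFieldNormedType.Exports.
(* [topology] has another [subspace]. *)
Import Defs.

Local Open Scope classical_set_scope.
Local Open Scope ring_scope.
Local Open Scope complex_scope.

(** * Hermitian forms and their real parts *)

Section HermitianForms.
Context {R : realType} {H : lmodType R[i]}.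
Implicit Types (g : H -> H -> R[i]) (x y z : H) (T : H -> H).

Definition hermitian_form g : Prop :=
  (forall a x y z, g (a *: x + y) z = a * g x z + g y z) /\
  (forall x y, g x y = conjc (g y x)).

(* In ring scope ['i] would be the [Num.imaginary] of the closed field [R[i]],
   which does not reduce. *)
Definition iC : R[i] := Complex 0 1.

(** Estimates are carried out on this real form, in the ordered field [R]; [g] is recovered from it
    through multiplication by [iC]. *)
Definition reform g x y : R := complex.Re (g x y).

Lemma complexP (a b : R[i]) :
  complex.Re a = complex.Re b -> complex.Im a = complex.Im b -> a = b.
Proof. by case: a b => [a1 a2] [b1 b2] /= -> ->. Qed.

Lemma Re_realM (r : R) (a : R[i]) : complex.Re (r%:C * a) = r * complex.Re a.
Proof. by case: a => a b /=; rewrite mul0r subr0. Qed.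

Lemma ReD (a b : R[i]) : complex.Re (a + b) = complex.Re a + complex.Re b.
Proof. by case: a b => [a1 a2] [b1 b2]. Qed.

Section Re.
Context g (hg : hermitian_form g).
Local Notation re := (reform g).

Lemma formDl x y z : g (x + y) z = g x z + g y z.
Proof. by have := hg.1 1 x y z; rewrite scale1r mul1r. Qed.

Lemma form0l z : g 0 z = 0.
Proof. by apply: (addrI (g 0 z)); rewrite -formDl !addr0. Qed.

Lemma formZl a x z : g (a *: x) z = a * g x z.
Proof. by have := hg.1 a x 0 z; rewrite addr0 form0l addr0. Qed.

Lemma reC x y : re x y = re y x.
Proof. by rewrite /reform hg.2; case: (g y x). Qed.

Lemma reDl x y z : re (x + y) z = re x z + re y z.
Proof. by rewrite /reform formDl ReD. Qed.

Lemma reDr x y z : re x (y + z) = re x y + re x z.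
Proof. by rewrite !(reC x) reDl. Qed.

Lemma reZl (r : R) x y : re (r%:C *: x) y = r * re x y.
Proof. by rewrite /reform formZl Re_realM. Qed.

Lemma reZr (r : R) x y : re x (r%:C *: y) = r * re x y.
Proof. by rewrite !(reC x) reZl. Qed.

Lemma reNl x y : re (- x) y = - re x y.
Proof. by apply: (addrI (re x y)); rewrite -reDl !subrr /reform form0l. Qed.

Lemma reNr x y : re x (- y) = - re x y.
Proof. by rewrite !(reC x) reNl. Qed.

Lemma re0l y : re 0 y = 0.
Proof. by rewrite /reform form0l. Qed.

Lemma re0r y : re y 0 = 0.
Proof. by rewrite reC re0l. Qed.

Definition reE := (reDl, reDr, reNl, reNr, reZl, reZr, re0l, re0r).

Lemma Im_form x y : complex.Im (g x y) = - re (iC *: x) y.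
Proof. by rewrite /reform formZl; case: (g x y) => a b /=; lra. Qed.

Lemma reil x y : re (iC *: x) y = - re x (iC *: y).
Proof.
apply: (canRL opprK); rewrite -Im_form hg.2 (reC x).
by rewrite -[RHS]opprK -Im_form; case: (g y x).
Qed.

Lemma reii x y : re (iC *: x) (iC *: y) = re x y.
Proof.
rewrite reil scalerA.
have -> : iC * iC = -1 by apply: complexP => /=; lra.
by rewrite scaleN1r reNr opprK.
Qed.

Lemma formZr a x y : g x (a *: y) = conjc a * g x y.
Proof. by rewrite hg.2 formZl rmorphM /= -hg.2. Qed.

Lemma reZconj a x y : re x (a *: y) = re (conjc a *: x) y.
Proof. by rewrite /reform formZr formZl. Qed.

Lemma form_realP (a b c d : H) : re a b = re c d ->
  re (iC *: a) b = re (iC *: c) d -> g a b = g c d.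
Proof. by move=> h1 h2; apply: complexP => //; rewrite !Im_form h2. Qed.

Lemma Im_form_self x : complex.Im (g x x) = 0.
Proof. by have := hg.2 x x; case: (g x x) => a b [] /= hb; lra. Qed.

Lemma form_ge0 x : (0 <= g x x) = (0 <= re x x).
Proof. by rewrite lecE /= Im_form_self eqxx. Qed.

Lemma form_le0 x : (g x x <= 0) = (re x x <= 0).
Proof. by rewrite lecE /= Im_form_self eqxx. Qed.

Lemma scale_split (a : R[i]) x :
  a *: x = (complex.Re a)%:C *: x + (complex.Im a)%:C *: (iC *: x).
Proof.
rewrite scalerA -scalerDl; congr (_ *: _).
by case: a => a b; apply: complexP => /=; lra.
Qed.

Lemma hermitian_op T : linear T -> adjoint_of g T T ->
  hermitian_form (fun x y => g (T x) y).
Proof.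
by move=> lT hT; split=> [a x y z|x y]; [rewrite lT hg.1|rewrite hT hg.2].
Qed.

(** Polarization: a real diagonal gives [re (T x) (iC *: x) = 0], and expanding this at
    [x + iC *: y] gives the symmetry of the real part. *)
Lemma hermitian_symmetric T : (forall x, complex.Im (g (T x) x) = 0) ->
  linear T -> adjoint_of g T T.
Proof.
move=> h0 lT.
have TD x y : T (x + y) = T x + T y by have := lT 1 x y; rewrite !scale1r.
have T0 : T 0 = 0 by apply: (addrI (T 0)); rewrite -TD !addr0.
have TZ a x : T (a *: x) = a *: T x by have := lT a x 0; rewrite T0 !addr0.
have h x : re (T x) (iC *: x) = 0.
  by have := h0 x; rewrite Im_form reil opprK.
have sym x y : re (T x) y = re x (T y).
  have := h (x + iC *: y); rewrite TD TZ !scalerDr !reE !h.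
  rewrite scalerA; have -> : iC * iC = -1 by apply: complexP => /=; lra.
  by rewrite scaleN1r !reNr reii (reil (T y)) h (reC (T y)); lra.
move=> x y; apply: form_realP; first exact: sym.
by rewrite -TZ sym.
Qed.

Lemma adjoint_re T Ts : linear T ->
  (forall x y, re (T x) y = re x (Ts y)) -> adjoint_of g T Ts.
Proof.
move=> lT h x y; apply: form_realP => //; rewrite -h; congr (re _ _).
have T0 : T 0 = 0.
  by apply: (addrI (T 0)); have := lT 1 0 0; rewrite !scale1r !addr0.
by have := lT iC x 0; rewrite T0 !addr0.
Qed.

End Re.

End HermitianForms.

(** * Linear maps and subspaces *)

Section LinearMaps.
Context {R : realType} {H : lmodType R[i]}.
Implicit Types (T : H -> H) (K : set H).

Section Linear.
Context T (lT : linear T).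

Lemma linD x y : T (x + y) = T x + T y.
Proof. by have := lT 1 x y; rewrite !scale1r. Qed.

Lemma lin0 : T 0 = 0.
Proof. by apply: (addrI (T 0)); rewrite -linD !addr0. Qed.

Lemma linZ a x : T (a *: x) = a *: T x.
Proof. by have := lT a x 0; rewrite lin0 !addr0. Qed.

Lemma linN x : T (- x) = - T x.
Proof. by rewrite -scaleN1r linZ scaleN1r. Qed.

Lemma linB x y : T (x - y) = T x - T y.
Proof. by rewrite linD linN. Qed.
End Linear.

Lemma linear_comp T1 T2 : linear T1 -> linear T2 -> linear (T1 \o T2).
Proof. by move=> h1 h2 a x y /=; rewrite h2 h1. Qed.

Lemma linear_id : linear (@idfun H).
Proof. by []. Qed.

Lemma linear_sub T1 T2 : linear T1 -> linear T2 -> linear (T1 \- T2).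
Proof.
move=> h1 h2 a x y /=; rewrite h1 h2 scalerBr opprD !addrA; congr (_ + _).
by rewrite addrAC.
Qed.

Section Subspace.
Context K (sK : subspace K).

Lemma sub0 : K 0.
Proof. by have [h _] := sK; exact/set_mem. Qed.

Lemma subP a x y : K x -> K y -> K (a *: x + y).
Proof. by move=> hx hy; apply/set_mem; apply: sK.2; exact/mem_set. Qed.

Lemma subD x y : K x -> K y -> K (x + y).
Proof. by move=> hx hy; have := subP 1 hx hy; rewrite scale1r. Qed.

Lemma subZ a x : K x -> K (a *: x).
Proof. by move=> hx; have := subP a hx sub0; rewrite addr0. Qed.

Lemma subN x : K x -> K (- x).
Proof. by move=> hx; rewrite -scaleN1r; exact: subZ. Qed.

Lemma subB x y : K x -> K y -> K (x - y).
Proof. by move=> hx hy; apply: subD => //; exact: subN. Qed.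
End Subspace.

Lemma subspaceP K : K 0 -> (forall a x y, K x -> K y -> K (a *: x + y)) ->
  subspace K.
Proof.
move=> h0 hP; split; first exact/mem_set.
by move=> a x y /set_mem hx /set_mem hy; apply/mem_set; exact: hP.
Qed.

Lemma subspaceT : subspace [set: H].
Proof. exact: subspaceP. Qed.

Lemma subspace_image T K : linear T -> subspace K -> subspace (T @` K).
Proof.
move=> lT sK; apply: subspaceP; first by exists 0; [exact: sub0|exact: lin0].
move=> a _ _ [x hx <-] [y hy <-]; exists (a *: x + y); first exact: subP.
exact: lT.
Qed.
End LinearMaps.

(** * Elementary Hilbert space geometry *)

Section Hilbert.
Context {R : realType} {H : lmodType R[i]}.

Record hilbert (g : H -> H -> R[i]) : Prop := Hilbert {
  hilbert_form : hermitian_form g;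
  hilbert_ge0 : forall x, 0 <= reform g x x;
  hilbert_eq0 : forall x, reform g x x = 0 -> x = 0;
  hilbert_complete : gcomplete g setT }.

(** For [0 < c] the minimum is at [r = - b / c]; for [c = 0] an affine function of [r] that stays
    nonnegative has slope 0. *)
Lemma discriminant_le (a b c : R) : 0 <= c ->
  (forall r : R, 0 <= a + 2 * r * b + r ^+ 2 * c) -> b ^+ 2 <= a * c.
Proof.
move=> c0 h; have [c_gt0|c_le0] := ltP 0 c.
  have := h (- (b / c)); rewrite sqrrN exprMn.
  have -> : a + 2 * - (b / c) * b + b ^+ 2 * c^-1 ^+ 2 * c = (a * c - b ^+ 2) / c.
    by field; rewrite gt_eqF.
  by rewrite pmulr_lge0 ?invr_gt0// subr_ge0.
have c00 : c = 0 by apply/eqP; rewrite eq_le c0 c_le0.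
rewrite c00 mulr0 le_eqVlt; apply/orP; left; rewrite sqrf_eq0; apply: contraT => b0.
have := h (- (a + 1) / (2 * b)); rewrite c00.
have -> : a + 2 * (- (a + 1) / (2 * b)) * b + (- (a + 1) / (2 * b)) ^+ 2 * 0 = - 1.
  by field.
by rewrite ler0N1.
Qed.

Lemma semidefinite_CS (g : H -> H -> R[i]) x y : hermitian_form g ->
  (forall z, 0 <= reform g z z) ->
  reform g x y ^+ 2 <= reform g x x * reform g y y.
Proof.
move=> hg h; apply: discriminant_le => // r.
have := h (x + r%:C *: y); rewrite !(reE hg) (reC hg y x).
by congr (_ <= _); ring.
Qed.

Section HilbertTheory.
Context (g : H -> H -> R[i]) (hh : hilbert g).
Local Notation hg := (hilbert_form hh).
Local Notation re := (reform g).
Local Notation nrm := (gnorm g).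
Implicit Types (x y z : H) (K A : set H) (T q : H -> H).

Lemma nrm_ge0 x : 0 <= nrm x.
Proof. exact: sqrtr_ge0. Qed.

Lemma nrm_sqr x : nrm x ^+ 2 = re x x.
Proof. by rewrite sqr_sqrtr //; exact: hilbert_ge0. Qed.

Lemma nrm0 : nrm 0 = 0.
Proof. by apply/eqP; rewrite -sqrf_eq0 nrm_sqr (re0l hg). Qed.

Lemma nrm_eq0 x : nrm x = 0 -> x = 0.
Proof. by move=> h; apply: (hilbert_eq0 hh); rewrite -nrm_sqr h expr0n. Qed.

Lemma abs_re_le x y : `|re x y| <= nrm x * nrm y.
Proof.
rewrite -(@ler_pXn2r _ 2) ?nnegrE ?mulr_ge0 ?nrm_ge0//.
rewrite real_normK ?num_real// exprMn !nrm_sqr.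
by apply: semidefinite_CS; [exact: hg|exact: hilbert_ge0].
Qed.

Lemma re_le x y : re x y <= nrm x * nrm y.
Proof. exact: le_trans (ler_norm _) (abs_re_le x y). Qed.

Lemma nrmN x : nrm (- x) = nrm x.
Proof. by rewrite /gnorm -!/(re _ _) !(reE hg) opprK. Qed.

Lemma nrmBC x y : nrm (x - y) = nrm (y - x).
Proof. by rewrite -nrmN opprB. Qed.

Lemma nrmD x y : nrm (x + y) <= nrm x + nrm y.
Proof.
rewrite -(@ler_pXn2r _ 2) ?nnegrE ?addr_ge0 ?nrm_ge0//.
rewrite nrm_sqr !(reE hg) sqrrD !nrm_sqr (reC hg y x).
by have := re_le x y; lra.
Qed.

Lemma nrmB_le x y z : nrm (x - z) <= nrm (x - y) + nrm (y - z).
Proof. by apply: le_trans (nrmD _ _); rewrite addrA subrK. Qed.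

Lemma nrmZ (r : R) x : nrm (r%:C *: x) = `|r| * nrm x.
Proof.
rewrite /gnorm -!/(re _ _) !(reE hg) mulrA sqrtrM ?sqr_ge0//.
by rewrite -expr2 sqrtr_sqr.
Qed.

Lemma nrmi x : nrm (iC *: x) = nrm x.
Proof. by rewrite /gnorm -!/(re _ _) (reii hg). Qed.

Lemma nrmZ_le (a : R[i]) x :
  nrm (a *: x) <= (`|complex.Re a| + `|complex.Im a|) * nrm x.
Proof.
rewrite scale_split mulrDl; apply: le_trans (nrmD _ _) _.
by rewrite !nrmZ nrmi.
Qed.

Lemma re_eq0 z : (forall x, re x z = 0) -> z = 0.
Proof. by move=> h; apply: (hilbert_eq0 hh); exact: h. Qed.

Lemma re_inj y z : (forall x, re x y = re x z) -> y = z.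
Proof.
move=> h; apply/eqP; rewrite -subr_eq0; apply/eqP/re_eq0 => x.
by rewrite !(reE hg) h subrr.
Qed.

Lemma form_inj y z : (forall x, g x y = g x z) -> y = z.
Proof. by move=> h; apply: re_inj => x; rewrite /reform h. Qed.

Lemma adjoint_linear T Ts : adjoint_of g T Ts -> linear T.
Proof.
move=> h a x y; apply: form_inj => z.
rewrite !(hg.2 z) h hg.1 -!h -hg.1; congr conjc; exact: h.
Qed.

Lemma adjoint_sym T Ts : adjoint_of g T Ts -> adjoint_of g Ts T.
Proof. by move=> h x y; rewrite hg.2 -h -hg.2. Qed.

Lemma adjoint_unique T T1 T2 : adjoint_of g T T1 -> adjoint_of g T T2 -> T1 = T2.
Proof.
by move=> h1 h2; apply/funext => y; apply: form_inj => x; rewrite -h1 -h2.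
Qed.

Lemma adjoint_reform T Ts x y : adjoint_of g T Ts -> re (T x) y = re x (Ts y).
Proof. by move=> h; rewrite /reform h. Qed.

Lemma nrm_cauchy (x : nat -> H) : gcauchy g x ->
  exists l, forall e : R, 0 < e ->
    exists N, forall n, (N <= n)%N -> nrm (x n - l) < e.
Proof.
move=> hx; have [l _ hl] := hilbert_complete hh (fun n => I : setT (x n)) hx.
exists l => e e0; have /cvgrPdist_lt /(_ e e0) [N _ hN] := hl.
exists N => n hn; have := hN n hn.
by rewrite /= sub0r normrN ger0_norm ?nrm_ge0.
Qed.

Lemma gclosure_sub A : A `<=` gclosure g A.
Proof. by move=> x hx e e0; exists x => //; rewrite subrr nrm0. Qed.

Lemma subspace_gclosure K : subspace K -> subspace (gclosure g K).
Proof.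
move=> sK; apply: subspaceP; first by apply: gclosure_sub; exact: sub0.
move=> a x y hx hy e e0.
set c := `|complex.Re a| + `|complex.Im a|.
have c0 : 0 <= c by rewrite addr_ge0.
have e1 : 0 < e / (2 * (c + 1)) by rewrite divr_gt0// mulr_gt0// ltr_wpDl.
have [x' hx' hxx] := hx _ e1.
have [y' hy' hyy] := hy (e / 2) ltac:(by rewrite divr_gt0).
exists (a *: x' + y'); first exact: subP.
rewrite opprD addrACA -scalerBr; apply: le_lt_trans (nrmD _ _) _.
have h1 : nrm (a *: (x - x')) <= e / 2.
  apply: le_trans (nrmZ_le _ _) _; rewrite -/c.
  apply: (@le_trans _ _ ((c + 1) * (e / (2 * (c + 1))))).
    by apply: ler_pM; rewrite ?nrm_ge0 ?lerDl ?ler01//; exact: ltW.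
  by rewrite le_eqVlt; apply/orP; left; apply/eqP; field; lra.
by lra.
Qed.

Lemma gclosed_gclosure A : gclosed g (gclosure g A).
Proof.
move=> x hx e e0; have e2 : 0 < e / 2 by rewrite divr_gt0.
have [y hy hxy] := hx _ e2; have [z hz hyz] := hy _ e2; exists z => //.
by apply: le_lt_trans (nrmB_le x y z) _; lra.
Qed.

Lemma gclosure_le A z (c : R) : (forall a, A a -> re a z <= c * nrm a) -> 0 <= c ->
  forall v, gclosure g A v -> re v z <= c * nrm v.
Proof.
move=> h c0 v hv; apply/ler_addgt0Pr => e e0.
(* Replacing [v] by [a] changes the two sides by at most [(c + nrm z) * nrm (v - a)] altogether; the
   [+ 1] keeps [d] positive. *)
set d := c + nrm z + 1.
have d0 : 0 < d by rewrite /d; have := nrm_ge0 z; lra.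
have [a ha hav] := hv (e / d) ltac:(by rewrite divr_gt0).
have -> : re v z = re a z + re (v - a) z by rewrite -(reDl hg) addrC subrK.
have h1 := h a ha; have h2 := re_le (v - a) z.
have h3 : nrm a <= nrm v + nrm (v - a).
  by have := nrmB_le a v 0; rewrite !subr0 (nrmBC a v) addrC.
have h4 : c * nrm a <= c * nrm v + c * nrm (v - a).
  by rewrite -mulrDr; exact: ler_wpM2l.
have h5 : nrm (v - a) * d <= e by rewrite -ler_pdivlMr//; exact: ltW.
by have := nrm_ge0 (v - a); rewrite /d in h5; lra.
Qed.

Lemma gclosure_perp A z v : (forall a, A a -> re a z = 0) ->
  gclosure g A v -> re v z = 0.
Proof.
move=> h hv; apply/eqP; rewrite eq_le.
have le0 w : (forall a, A a -> re a w = 0) -> re v w <= 0.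
  move=> hw; rewrite -(mul0r (nrm v)); apply: (@gclosure_le A) => // a ha.
  by rewrite mul0r hw.
rewrite le0//= -oppr_le0 -(reNr hg); apply: le0 => a ha.
by rewrite (reNr hg) h ?oppr0.
Qed.

Lemma gclosure_perp_eq0 K z : subspace K -> gclosure g K z ->
  (forall a, K a -> re a z = 0) -> z = 0.
Proof. by move=> sK hz h; apply: (hilbert_eq0 hh); exact: (gclosure_perp h). Qed.

End HilbertTheory.
End Hilbert.

(** * Representation, uniform boundedness, adjoints and projections *)

Section HilbertTools.
Context {R : realType} {H : lmodType R[i]}.

Lemma le0_small (x c : R) : (forall e, 0 < e -> x <= e * c) -> x <= 0.
Proof.
move=> h; apply/ler_addgt0Pr => e e0; rewrite add0r.
set d := `|c| + 1; have d0 : 0 < d by rewrite /d; have := normr_ge0 c; lra.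
apply: le_trans (h (e / d) _) _; first by rewrite divr_gt0.
rewrite -mulrA ger_pMr// mulrC ler_pdivrMr// mul1r /d.
by have := ler_norm c; lra.
Qed.

Lemma invS_lt (e : R) : 0 < e ->
  exists N, forall n, (N <= n)%N -> (n.+1%:R)^-1 < e.
Proof.
move=> e0; exists (Num.bound e^-1) => n hn.
rewrite invf_plt ?posrE//; apply: lt_le_trans (archi_boundP _) _.
  by rewrite invr_ge0 ltW.
by rewrite ler_nat leqW.
Qed.

Context (g : H -> H -> R[i]) (hh : hilbert g).
Local Notation hg := (hilbert_form hh).
Local Notation re := (reform g).
Local Notation nrm := (gnorm g).
Implicit Types (x y z : H) (K A : set H) (T q : H -> H).

(* [z] is the limit of [q s_n] for a minimizing sequence [s_n] of
   [|q s|^2 - 2 l s] in [K]. *)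
Lemma riesz_seminorm K q (l : H -> R) (C : R) : subspace K -> linear q ->
  (forall (r : R) s t, K s -> K t -> l (r%:C *: s + t) = r * l s + l t) ->
  (forall s, K s -> l s <= C * nrm (q s)) ->
  exists2 z, gclosure g (q @` K) z & forall s, K s -> re (q s) z = l s.
Proof.
move=> sK lq hl hb.
have lD s t : K s -> K t -> l (s + t) = l s + l t.
  by move=> hs ht; have := hl 1 _ _ hs ht; rewrite scale1r mul1r.
have l0 : l 0 = 0.
  by have := lD 0 0 (sub0 sK) (sub0 sK); rewrite addr0; lra.
have lZ (r : R) s : K s -> l (r%:C *: s) = r * l s.
  by move=> hs; have := hl r _ _ hs (sub0 sK); rewrite !addr0 l0 addr0.
pose phi s := re (q s) (q s) - 2 * l s.
pose E := [set phi s | s in K].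
have E0 : E !=set0 by exists (phi 0); exists 0 => //; exact: sub0.
have Elb : lbound E (- C ^+ 2).
  move=> _ [s hs <-]; rewrite /phi -(nrm_sqr hh).
  have := hb s hs; have := sqr_ge0 (nrm (q s) - C); rewrite sqrrB; lra.
have hE : has_inf E by split=> //; exists (- C ^+ 2).
set m := inf E.
have hm s : K s -> m <= phi s.
  by move=> hs; apply: ge_inf; [exists (- C ^+ 2)|exists s].
(* [phi (s + r t) - m] is a nonnegative quadratic in [r] with constant term at most [d]. *)
have discr s t (d : R) : K s -> K t -> phi s <= m + d ->
    (re (q s) (q t) - l t) ^+ 2 <= d * re (q t) (q t).
  move=> hs ht hd; apply: discriminant_le; first exact: hilbert_ge0.
  move=> r; have := hm _ (subP sK r%:C ht hs).
  rewrite /phi hl// lq !(reE hg) (reC hg (q t) (q s)).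
  by rewrite /phi in hd; nra.
have /choice[s hs] : forall n : nat, exists s, K s /\ phi s < m + (n.+1%:R)^-1.
  move=> n; have [|_ [s hs <-] hlt] := inf_adherent (_ : 0 < (n.+1%:R)^-1 :> R) hE.
    by rewrite invr_gt0.
  by exists s.
(* Parallelogram law: [phi] is still at least [m] at the midpoint of [s n] and [s k]. *)
have par n k : nrm (q (s n) - q (s k)) ^+ 2 <= 2 * (n.+1%:R)^-1 + 2 * (k.+1%:R)^-1.
  have [hn hn'] := hs n; have [hk hk'] := hs k.
  have := hm _ (subZ sK (2^-1)%:C (subD sK hn hk)).
  rewrite /phi lZ ?lD//; last exact: subD.
  rewrite linZ// linD// (nrm_sqr hh) !(reE hg) (reC hg (q (s k))).
  move: hn' hk'; rewrite /phi; move: (n.+1%:R^-1) (k.+1%:R^-1) => dn dk; lra.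
have hc : gcauchy g (q \o s).
  move=> e e0; have e1 : 0 < e ^+ 2 / 4 by rewrite divr_gt0// exprn_gt0.
  have [N hN] := invS_lt e1; exists N => n k hn hk.
  rewrite -(@ltr_pXn2r _ 2) ?nnegrE ?nrm_ge0 ?(ltW e0)//.
  by apply: le_lt_trans (par _ _) _; have := hN n hn; have := hN k hk;
  move: (n.+1%:R^-1) (k.+1%:R^-1) (e ^+ 2) => dn dk d; lra.
have [z hz] := nrm_cauchy hh hc; exists z.
  move=> e e0; have [N hN] := hz e e0; exists (q (s N)).
    by exists (s N) => //; have [] := hs N.
  by rewrite (nrmBC hh); exact: hN.
move=> t ht; apply/eqP; rewrite -subr_eq0 -sqrf_eq0 eq_le sqr_ge0 andbT.
apply: (@le0_small _ (4 * re (q t) (q t))) => e e0.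
have [N1 hN1] := hz (Num.sqrt e) ltac:(by rewrite sqrtr_gt0).
have [N2 hN2] := invS_lt e0.
pose n := maxn N1 N2.
have h6 := discr _ t _ (hs n).1 ht (ltW (hs n).2).
have h1 := hN1 n (leq_maxl _ _); have h2 := hN2 n (leq_maxr _ _).
have h3 := abs_re_le hh (q (s n) - z) (q t).
have h4 : (re (q (s n) - z) (q t)) ^+ 2 <= e * re (q t) (q t).
  apply: le_trans (semidefinite_CS _ _ hg (hilbert_ge0 hh)) _.
  rewrite -(nrm_sqr hh (q (s n) - z)); apply: ler_wpM2r; first exact: hilbert_ge0.
  have e1 := ltW e0; rewrite -[leRHS]sqr_sqrtr//.
  by rewrite ler_pXn2r ?nnegrE ?nrm_ge0 ?sqrtr_ge0// ltW.
have h5 : (n.+1%:R)^-1 * re (q t) (q t) <= e * re (q t) (q t).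
  by apply: ler_wpM2r; [exact: hilbert_ge0|exact: ltW].
move: h4 (le_trans h6 h5); rewrite (reC hg (q t) z) !(reE hg).
move: (re (q (s n)) (q t)) (re z (q t)) (re (q t) (q t)) => a b c h4 {}h6.
have -> : b - l t = (a - l t) - (a - b) by ring.
have := sqr_ge0 ((a - l t) + (a - b)); nra.
Qed.

(* Gliding hump: [x n] is chosen in [A] so large that the sign of the n-th
   term of [y = sum_n (+/-) 3^-n x n / |x n|] can be picked to make
   [|re (x n) y|] at least [n]. *)
Lemma uniform_boundedness A :
  (forall y, exists C : R, forall x, A x -> re x y <= C) ->
  exists M : R, forall x, A x -> nrm x <= M.
Proof.
move=> hA; apply: contrapT => hM.
(* Then [nrm (x n) / 3 ^+ n] exceeds [2 * n.+1], and half of it can be lost to the tail of the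
   series. *)
have /choice[x hx] : forall n : nat, exists x, A x /\ n.+1%:R * 3 ^+ n * 2 < nrm x.
  move=> n; apply: contrapT => hn; apply: hM.
  exists (n.+1%:R * 3 ^+ n * 2) => x hx; rewrite leNgt; apply/negP => hlt.
  by apply: hn; exists x.
have x0 n : 0 < nrm (x n).
  by apply: le_lt_trans (hx n).2; rewrite !mulr_ge0// exprn_ge0.
pose e n := ((3 ^+ n * nrm (x n))^-1)%:C *: x n.
have ne n : nrm (e n) = (3 ^+ n)^-1.
  rewrite /e nrmZ// ger0_norm ?invr_ge0 ?mulr_ge0 ?exprn_ge0 ?nrm_ge0//.
  by rewrite invfM -mulrA mulVf ?mulr1// gt_eqF.
have xe n : re (x n) (e n) = nrm (x n) / 3 ^+ n.
  rewrite /e (reZr hg) -(nrm_sqr hh); field.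
  by rewrite !gt_eqF ?exprn_gt0.
clearbody e.
pose y := fix y n := if n is k.+1 then
   if 0 <= re (x k) (y k) then y k + e k else y k - e k else 0.
have dy n : nrm (y n.+1 - y n) = (3 ^+ n)^-1.
  rewrite /=; case: ifP => _; rewrite addrC addrA addNr add0r ?nrmN//.
(* The sign chosen for [e n] agrees with that of [re (x n) (y n)], so the two contributions do not
   cancel. *)
have xy n : nrm (x n) / 3 ^+ n <= `|re (x n) (y n.+1)|.
  have p0 : 0 < nrm (x n) / 3 ^+ n by rewrite divr_gt0// exprn_gt0.
  rewrite /=; case: ifP => [h|/negbT]; rewrite ?(reE hg) xe;
    move: p0; set p := _ / _ => p0.
    by rewrite ger0_norm; lra.
  by rewrite -ltNge => h; rewrite ler0_norm; lra.
have tail n k : nrm (y (n + k)%N - y n) <=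
    (3 ^+ n)^-1 * (3 / 2) - (3 ^+ (n + k))^-1 * (3 / 2).
  elim: k => [|k ih]; first by rewrite addn0 !subrr nrm0.
  rewrite addnS; apply: le_trans (nrmB_le hh _ (y (n + k)%N) _) _; rewrite dy.
  have -> : (3 ^+ (n + k).+1)^-1 = (3 ^+ (n + k))^-1 / 3 :> R by rewrite exprS invfM mulrC.
  by move: ih; move: ((3 ^+ (n + k))^-1) ((3 ^+ n)^-1) => u v; lra.
have tail' n m : (n <= m)%N -> nrm (y m - y n) <= (3 ^+ n)^-1 * (3 / 2).
  move=> /subnKC <-; apply: le_trans (tail _ _) _.
  rewrite lerBlDr lerDl; apply: mulr_ge0; last by rewrite divr_ge0.
  by rewrite invr_ge0 exprn_ge0.
have pow n : (3 ^+ n)^-1 <= (n.+1%:R)^-1 :> R.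
  rewrite lef_pV2 ?posrE ?exprn_gt0// -natrX ler_nat.
  elim: n => // n ih; rewrite expnS; apply: leq_ltn_trans ih _.
  by rewrite ltn_Pmull// expn_gt0.
have hc : gcauchy g y.
  move=> d d0; have d1 : 0 < d / 4 by rewrite divr_gt0.
  have [N' hN'] := invS_lt d1; exists N' => n k hn hk.
  apply: le_lt_trans (nrmB_le hh _ (y N') _) _.
  rewrite (nrmBC hh (y N')); have := tail' _ _ hn; have := tail' _ _ hk.
  have := pow N'; have := hN' N' (leqnn _).
  by move: (N'.+1%:R^-1) ((3 ^+ N')^-1) => dn dk; lra.
have [l hl] := nrm_cauchy hh hc.
have hln n : nrm (l - y n) <= (3 ^+ n)^-1 * (3 / 2).
  apply/ler_addgt0Pr => d d0; have [N hN] := hl d d0.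
  apply: le_trans (nrmB_le hh _ (y (maxn n N)) _) _.
  have := hN _ (leq_maxr n N); rewrite (nrmBC hh l) => h1.
  by have := tail' _ _ (leq_maxl n N); lra.
(* The tail beyond [y n.+1] pairs with [x n] to at most half of [nrm (x n) / 3 ^+ n]. *)
have big n : n.+1%:R <= `|re (x n) l|.
  have h1 := abs_re_le hh (x n) (l - y n.+1).
  have h2 : nrm (x n) * nrm (l - y n.+1) <= nrm (x n) * ((3 ^+ n.+1)^-1 * (3 / 2)).
    by apply: ler_wpM2l; [exact: nrm_ge0|exact: hln].
  have h3 := xy n.
  have h4 : n.+1%:R * 2 <= nrm (x n) / 3 ^+ n.
    rewrite ler_pdivlMr ?exprn_gt0//; have := (hx n).2; rewrite mulrAC => h.
    exact: ltW.
  have h5 : `|re (x n) (y n.+1)| <= `|re (x n) l| + `|re (x n) (l - y n.+1)|.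
    have -> : re (x n) (y n.+1) = re (x n) l - re (x n) (l - y n.+1).
      by rewrite !(reE hg); ring.
    exact: ler_normB.
  move: h2; rewrite exprS invfM.
  have -> : nrm (x n) * (3^-1 * (3 ^+ n)^-1 * (3 / 2)) = (nrm (x n) / 3 ^+ n) / 2.
    by field; rewrite gt_eqF// exprn_gt0.
  by lra.
have [C1 hC1] := hA l; have [C2 hC2] := hA (- l).
pose n := Num.bound (`|C1| + `|C2|).
have := big n; have := hC1 _ (hx n).1; have := hC2 _ (hx n).1.
rewrite (reNr hg) => h2 h1.
have hn : `|C1| + `|C2| < n%:R by apply: archi_boundP; rewrite addr_ge0.
have hn' : n%:R <= n.+1%:R :> R by rewrite ler_nat.
have c1 := ler_norm C1; have c2 := ler_norm C2.
have p1 := normr_ge0 C1; have p2 := normr_ge0 C2.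
have : `|re (x n) l| <= `|C1| + `|C2| by rewrite ler_norml; lra.
by lra.
Qed.

End HilbertTools.

Section BoundedOperators.
Context {R : realType} {H : lmodType R[i]}.
Context (g : H -> H -> R[i]) (hh : hilbert g).
Local Notation hg := (hilbert_form hh).
Local Notation re := (reform g).
Local Notation nrm := (gnorm g).
Implicit Types (x y z : H) (K A S : set H) (T q f X P : H -> H).

(** Uniform boundedness applied to the vectors [T s] with [s] in [K] and [nrm (q s) <= 1]. *)
Lemma pointwise_bounded_seminorm K q T : subspace K -> linear q -> linear T ->
  (forall y, exists C : R, forall s, K s -> re (T s) y <= C * nrm (q s)) ->
  exists2 M : R, 0 <= M & forall s, K s -> nrm (T s) <= M * nrm (q s).
Proof.
move=> sK lq lT hb.
have [|M hM] := uniform_boundedness hh (A := T @` [set s | K s /\ nrm (q s) <= 1]).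
  move=> y; have [C hC] := hb y; exists `|C| => _ [s [hs h1] <-].
  apply: le_trans (hC s hs) _; apply: le_trans (ler_norm _) _.
  by rewrite normrM (ger0_norm (nrm_ge0 _ _)) ler_piMr.
exists `|M| => // s hs; rewrite -subr_le0.
(* Since [q s] may vanish, [s] is normalized by [nrm (q s) + e], with [e] arbitrarily small. *)
apply: (@le0_small _ _ `|M|) => e e0; rewrite lerBlDr.
have v0 : 0 < nrm (q s) + e by have := nrm_ge0 g (q s); lra.
have := hM (T (((nrm (q s) + e)^-1)%:C *: s)) _; rewrite linZ// nrmZ//.
rewrite gtr0_norm ?invr_gt0// ler_pdivrMl//.
have imp : [set T s | s in [set s | K s /\ nrm (q s) <= 1]]
    ((nrm (q s) + e)^-1%:C *: T s).
  exists (((nrm (q s) + e)^-1)%:C *: s); last by rewrite linZ.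
  split; first exact: subZ.
  rewrite linZ// nrmZ// gtr0_norm ?invr_gt0// ler_pdivrMl// mulr1; lra.
move=> /(_ imp) h; apply: le_trans h _.
have : (nrm (q s) + e) * M <= (nrm (q s) + e) * `|M|.
  by apply: ler_wpM2l; [exact: ltW|exact: ler_norm].
by lra.
Qed.

Lemma bounded_nonneg T : bounded_op g T ->
  exists2 M : R, 0 <= M & forall x, nrm (T x) <= M * nrm x.
Proof.
move=> [lT [M hM]]; exists `|M| => // x; apply: le_trans (hM x) _.
by apply: ler_wpM2r; [exact: nrm_ge0|exact: ler_norm].
Qed.

(** Each functional [re (T _) y] is bounded by [nrm (Ts y)]; uniform boundedness then bounds [T]. *)
Lemma hellinger_toeplitz T Ts : adjoint_of g T Ts -> bounded_op g T.
Proof.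
move=> hT; have lT := adjoint_linear hh hT; split => //.
have [|M M0 hM] := pointwise_bounded_seminorm subspaceT (@linear_id _ H) lT.
  move=> y; exists (nrm (Ts y)) => s _; rewrite (adjoint_reform _ _ hT) mulrC.
  exact: re_le.
by exists M => x; exact: hM.
Qed.

Lemma bounded_adjoint T : bounded_op g T -> exists Ts, adjoint_of g T Ts.
Proof.
move=> bT; have lT := bT.1; have [M M0 hM] := bounded_nonneg bT.
have /choice[Ts hTs] : forall y, exists z, forall x, re x z = re (T x) y.
  move=> y; have [||z _ hz] := @riesz_seminorm _ _ g hh setT idfun
      (fun x => re (T x) y) (M * nrm y) subspaceT (@linear_id _ H).
  - by move=> r s t _ _; rewrite lT !(reE hg).
  - move=> s _; rewrite mulrAC; apply: le_trans (re_le hh _ _) _.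
    by apply: ler_wpM2r; [exact: nrm_ge0|exact: hM].
  by exists z => x; exact: hz.
by exists Ts; apply: (adjoint_re hg) => // x y; rewrite hTs.
Qed.

(** Douglas' lemma on [K]: [f y] is the Riesz representative of [s |-> <T s, y>] with respect to
    [q]. Lying in the closure of [q K] makes it unique, whence the linearity of [f]. *)
Lemma douglas K q T : subspace K -> linear q -> linear T ->
  (forall y, exists C : R, forall s, K s -> re (T s) y <= C * nrm (q s)) ->
  exists f fs, [/\ adjoint_of g f fs, forall y, gclosure g (q @` K) (f y)
    & forall s y, K s -> g (q s) (f y) = g (T s) y].
Proof.
move=> sK lq lT hb.
have sqK := subspace_image lq sK.
have scl := subspace_gclosure hh sqK.
have /choice[f hf] : forall y, exists z, gclosure g (q @` K) z /\
    forall s, K s -> re (q s) z = re (T s) y.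
  move=> y; have [C hC] := hb y.
  have [|z hz1 hz2] := @riesz_seminorm _ _ g hh K q
      (fun s => re (T s) y) C sK lq _ hC; last by exists z.
  by move=> r s t _ _; rewrite lT !(reE hg).
have hgf s y : K s -> g (q s) (f y) = g (T s) y.
  move=> hs; apply: (form_realP hg); rewrite ?(hf y).2//.
  by rewrite -(linZ lq) -(linZ lT) (hf y).2//; exact: subZ.
have lf : linear f.
  move=> a y z; apply/eqP; rewrite -subr_eq0; apply/eqP.
  apply: (gclosure_perp_eq0 hh sqK).
    by apply: (subB scl); [|apply: (subP scl)]; exact: (hf _).1.
  move=> _ [s hs <-]; rewrite !(reE hg) (hf _).2// (hf z).2// !(reZconj hg).
  by rewrite -(linZ lq) (hf y).2 ?(linZ lT) ?(reE hg) -?(reZconj hg);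
    [ring|exact: subZ].
have [M M0 hM] := pointwise_bounded_seminorm sK lq lT hb.
have bf : bounded_op g f.
  split=> //; exists M => y; have [f0|fn0] := eqVneq (nrm (f y)) 0.
    by rewrite f0 mulr_ge0 ?nrm_ge0.
  have fp : 0 < nrm (f y) by rewrite lt_neqAle eq_sym fn0 nrm_ge0.
  (* [|f y|^2] is bounded by testing [<v, f y>] on [v = q s] and passing to the closure, which
     contains [f y]. *)
  rewrite -(ler_pM2r fp) -expr2 (nrm_sqr hh).
  apply: (gclosure_le hh _ _ (hf y).1); last by rewrite mulr_ge0 ?nrm_ge0.
  move=> _ [s hs <-]; rewrite (hf y).2// mulrAC.
  apply: le_trans (re_le hh _ _) _.
  by apply: ler_wpM2r; [exact: nrm_ge0|exact: hM].
have [fs hfs] := bounded_adjoint bf.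
by exists f, fs; split=> // y; exact: (hf y).1.
Qed.

Lemma form0P (x y : H) : g x y = 0 -> g y x = 0.
Proof. by move=> h; rewrite hg.2 h rmorph0. Qed.

Lemma orthogonal_projectionP S P : orthogonal_projection g S P ->
  [/\ linear P, forall x, S (P x), forall s, S s -> P s = s & adjoint_of g P P].
Proof.
move=> [lP PP rP nP]; have PS x : S (P x) by rewrite -rP; exists x.
have hp x y : re (P x) (y - P y) = 0.
  rewrite /reform; suff -> : g (P x) (y - P y) = 0 by [].
  apply: form0P; have : nullspace P (y - P y).
    by rewrite /nullspace /= linB// -[P (P y)]/((P \o P) y) PP subrr.
  by rewrite nP; apply; exact: PS.
split=> // [s|]; first by rewrite -rP => -[x _ <-]; exact: (congr1 (@^~ x) PP).
apply: (adjoint_re hg) => // x y; have := hp x y; have := hp y x.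
by rewrite !(reE hg) (reC hg (P y) x) (reC hg (P y) (P x)); lra.
Qed.

(** The case [q = T = id] of [douglas]: [P y] lies in the closed subspace [S] and represents
    [s |-> <s, y>]. *)
Lemma projection_exists S : subspace S -> gclosed g S ->
  exists P, orthogonal_projection g S P.
Proof.
move=> sS cS.
have [|P [Ps [hP hP1 hP2]]] := douglas sS (@linear_id _ H) (@linear_id _ H).
  by move=> y; exists (nrm y) => s _; rewrite mulrC; exact: re_le.
have PS y : S (P y) by apply: cS; have := hP1 y; rewrite image_id.
have lP := adjoint_linear hh hP.
have Pid s : S s -> P s = s.
  move=> hs; apply/eqP; rewrite -subr_eq0; apply/eqP; apply: (hilbert_eq0 hh).
  rewrite {2}/GRing.add /= (reDr hg) (reNr hg).
  rewrite /reform hP2 ?subrr//; exact: (subB sS).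
exists P; split=> //.
- by apply/funext => x /=; rewrite Pid.
- by apply/seteqP; split=> [_ [x _ <-]//|s hs]; exists s => //; exact: Pid.
- apply/seteqP; split=> x /= hx; last first.
    apply: (hilbert_eq0 hh); rewrite /reform hP2//.
    by rewrite form0P//; apply: hx; exact: PS.
  by move=> s hs; apply: form0P; rewrite -hP2// hx (hg.2 s) (form0l hg) rmorph0.
Qed.

End BoundedOperators.

(** * Square roots of positive operators *)

Section SquareRoots.
Context {R : realType} {H : lmodType R[i]}.
Context (g : H -> H -> R[i]) (hh : hilbert g).
Local Notation hg := (hilbert_form hh).
Local Notation re := (reform g).
Local Notation nrm := (gnorm g).
Implicit Types (x y z : H) (T Q X : H -> H).

(** Nonnegativity in [R[i]] includes being real, so polarization applies to the diagonal of [T]. *)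
Lemma positive_sym T : positive_op g T -> adjoint_of g T T.
Proof.
move=> [[lT _] h]; apply: (hermitian_symmetric hg) => // x.
exact: ger0_Im.
Qed.

Lemma positive_form T : positive_op g T -> hermitian_form (fun x y => g (T x) y).
Proof. by move=> pT; apply: (hermitian_op hg pT.1.1); exact: positive_sym. Qed.

Lemma positive_re T x : positive_op g T -> 0 <= re (T x) x.
Proof. by move=> pT; have := pT.2 x; rewrite (form_ge0 (positive_form pT)). Qed.

Lemma positive_CS T x y : positive_op g T ->
  re (T x) y ^+ 2 <= re (T x) x * re (T y) y.
Proof.
move=> pT; apply: (semidefinite_CS x y (positive_form pT)) => z.
exact: positive_re.
Qed.

Lemma positive_eq0 T x : positive_op g T -> re (T x) x = 0 -> T x = 0.
Proof.
move=> pT h; apply: (hilbert_eq0 hh); apply/eqP; rewrite -sqrf_eq0 eq_le sqr_ge0 andbT.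
by apply: le_trans (positive_CS _ _ pT) _; rewrite h mul0r.
Qed.

Lemma symmetric_positive T : linear T -> (forall x y, re (T x) y = re x (T y)) ->
  (forall x, 0 <= re (T x) x) -> positive_op g T.
Proof.
move=> lT sT h; have aT := adjoint_re hg lT sT; split; first exact: hellinger_toeplitz aT.
by move=> x; rewrite (form_ge0 (hermitian_op hg lT aT)); exact: h.
Qed.

Fixpoint sqrt_radius n : R :=
  if n is k.+1 then (1 + sqrt_radius k ^+ 2) / 2 else 0.
Local Notation c := sqrt_radius.

(** With [d = 1 - c n], one step yields [d - d ^+ 2 / 2]. This expression increases on [[0, 1]], so
    the bound [2 / n.+2] propagates. *)
Lemma sqrt_radius_bounds n : [/\ 0 <= c n, c n <= 1 & 1 - c n <= 2 / n.+2%:R].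
Proof.
elim: n => [|n [h0 h1 h2]] /=; first by split=> //; lra.
split; [by rewrite divr_ge0// addr_ge0// sqr_ge0| |].
  by rewrite ler_pdivrMr//; nra.
have n0 : 0 <= n%:R :> R by [].
have -> : 1 - (1 + c n ^+ 2) / 2 = (1 - c n) - (1 - c n) ^+ 2 / 2 by field.
move: h2; set d := 1 - c n; have d1 : d <= 1 by rewrite /d; lra.
rewrite -[n.+2%:R]natr1 -[n.+1%:R]natr1 -[n.+3%:R]natr1 -[n.+2%:R]natr1.
rewrite -[n.+1%:R]natr1.
set m : R := n%:R in n0 *; set b := 2 / (m + 1 + 1) => hb.
have bd : b <= 1 by rewrite /b ler_pdivrMr; lra.
apply: (@le_trans _ _ (b - b ^+ 2 / 2)); first by nra.
rewrite -subr_ge0 /b.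
have -> : 2 / (m + 1 + 1 + 1) - (2 / (m + 1 + 1) - (2 / (m + 1 + 1)) ^+ 2 / 2)
   = 2 / ((m + 3) * (m + 2) ^+ 2).
  by field; rewrite !gt_eqF//; lra.
by rewrite divr_ge0// mulr_ge0 ?sqr_ge0//; lra.
Qed.

Lemma sqrt_radius_mono n m : (n <= m)%N -> c n <= c m.
Proof.
move=> /subnKC <-; elim: (m - n)%N => [|k ih]; first by rewrite addn0.
rewrite addnS; apply: le_trans ih _ => /=; rewrite ler_pdivlMr//.
by have := sqr_ge0 (1 - c (n + k)); nra.
Qed.

Lemma sqrt_radius_cvg (e : R) : 0 < e ->
  exists N, forall n, (N <= n)%N -> 1 - c n < e.
Proof.
move=> e0; have e1 : 0 < e / 2 by rewrite divr_gt0.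
have [N hN] := invS_lt e1; exists N => n hn.
have [_ _ h] := sqrt_radius_bounds n; apply: le_lt_trans h _.
have := hN n.+1 (leqW hn); move: (n.+2%:R^-1) => u; lra.
Qed.

Lemma sqrt_radius_small (a b : R) : 0 <= b ->
  (forall n, a <= (1 - c n) * b) -> a <= 0.
Proof.
move=> b0 h; apply: (@le0_small _ _ b) => e e0.
have [N hN] := sqrt_radius_cvg e0; apply: le_trans (h N) _.
by apply: ler_wpM2r => //; exact/ltW/hN.
Qed.

(** This is [T^2 <= M T], by Cauchy-Schwarz for the form of [T] at [x] and [T x]. *)
Lemma positive_sqr_le T (M : R) x : positive_op g T -> 0 <= M ->
  (forall x, nrm (T x) <= M * nrm x) -> re (T x) (T x) <= M * re (T x) x.
Proof.
move=> pT M0 hM; have h := positive_CS x (T x) pT.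
have h1 : re (T (T x)) (T x) <= M * re (T x) (T x).
  apply: le_trans (re_le hh _ _) _; rewrite -(nrm_sqr hh) expr2 mulrA.
  by apply: ler_wpM2r; [exact: nrm_ge0|exact: hM].
have h2 := positive_re x pT; have h3 := hilbert_ge0 hh (T x).
have [t0|tn0] := eqVneq (re (T x) (T x)) 0; first by rewrite t0 mulr_ge0.
have tp : 0 < re (T x) (T x) by rewrite lt_neqAle eq_sym tn0.
rewrite -(ler_pM2r tp) -expr2; apply: le_trans h _.
by rewrite mulrC mulrAC; apply: ler_wpM2r.
Qed.

(* With [A] a contraction, [Y_(n+1) = (A + Y_n^2) / 2] converges in norm to a
   solution of [(1 - Y)^2 = 1 - A]; [sqrt_radius] is the same iteration for
   [A = 1], whose increments dominate those of [Y_n]. *)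
Section Iteration.
Context (A : H -> H) (lA : linear A) (hA : forall x, nrm (A x) <= nrm x).

Fixpoint sqrt_iter n x : H :=
  if n is k.+1 then (2^-1)%:C *: (A x + sqrt_iter k (sqrt_iter k x)) else 0.
Local Notation Y := sqrt_iter.

Lemma sqrt_iter_linear n : linear (Y n).
Proof.
elim: n => [|n ih] a x y /=; first by rewrite scaler0 addr0.
rewrite lA !ih scalerA [a * _]mulrC -scalerA -scalerDr; congr (_ *: _).
by rewrite scalerDr addrACA.
Qed.

Lemma sqrt_iter_bound n x : nrm (Y n x) <= c n * nrm x.
Proof.
elim: n x => [|n ih] x /=; first by rewrite (nrm0 hh) mul0r.
rewrite nrmZ// ger0_norm ?invr_ge0// mulrC ler_pdivrMr// mulrAC divfK ?pnatr_eq0//.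
apply: le_trans (nrmD hh _ _) _; rewrite mulrDl mul1r; apply: lerD => //.
apply: le_trans (ih _) _; rewrite expr2 -mulrA; apply: ler_wpM2l => //.
by have [] := sqrt_radius_bounds n.
Qed.

Lemma sqrt_iter_step n x : nrm (Y n.+1 x - Y n x) <= (c n.+1 - c n) * nrm x.
Proof.
elim: n x => [|n ih] x.
  have := sqrt_iter_bound 1 x; rewrite subr0 /= subr0; exact.
(* The two summands are bounded by [(c n.+1 + c n) * (c n.+1 - c n)] times [nrm x], and half of that
   factor is [c n.+2 - c n.+1]. *)
have -> : Y n.+2 x - Y n.+1 x = (2^-1)%:C *:
   (Y n.+1 (Y n.+1 x - Y n x) + (Y n.+1 (Y n x) - Y n (Y n x))).
  rewrite (linB (sqrt_iter_linear n.+1)) addrA subrK.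
  by rewrite [Y n.+2 x]/= [X in _ - X]/= -scalerBr opprD addrACA subrr add0r.
rewrite nrmZ// ger0_norm ?invr_ge0//.
have h1 := sqrt_iter_bound n.+1 (Y n.+1 x - Y n x).
have h2 := ih (Y n x); have h3 := sqrt_iter_bound n x; have h4 := ih x.
have h5 := nrmD hh (Y n.+1 (Y n.+1 x - Y n x)) (Y n.+1 (Y n x) - Y n (Y n x)).
have c1 := sqrt_radius_mono (leqnSn n).
have [c2 _ _] := sqrt_radius_bounds n.+1.
have h6 : c n.+1 * nrm (Y n.+1 x - Y n x) <= c n.+1 * ((c n.+1 - c n) * nrm x).
  exact: ler_wpM2l.
have h7 : (c n.+1 - c n) * nrm (Y n x) <= (c n.+1 - c n) * (c n * nrm x).
  by apply: ler_wpM2l => //; rewrite subr_ge0.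
have e2 : c n.+2 = (1 + c n.+1 ^+ 2) / 2 by [].
have e1 : c n.+1 = (1 + c n ^+ 2) / 2 by [].
move: e2; set u := c n.+2; move=> ->; move: e1 h6 h7 h5 h1 h2.
move: (c n.+1) (c n) (nrm x) => b a r -> *.
by rewrite ler_pdivrMl//; nra.
Qed.

Lemma sqrt_iter_cauchy n m x : (n <= m)%N ->
  nrm (Y m x - Y n x) <= (c m - c n) * nrm x.
Proof.
move=> /subnKC <-; elim: (m - n)%N => [|k ih].
  by rewrite addn0 !subrr mul0r nrm0.
rewrite addnS; apply: le_trans (nrmB_le hh _ (Y (n + k)%N x) _) _.
by have := sqrt_iter_step (n + k) x; lra.
Qed.

(** The increments telescope to [c m - c n], which is at most [1 - c n]. *)
Lemma sqrt_iter_limit : exists L : H -> H,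
  forall n x, nrm (L x - Y n x) <= (1 - c n) * nrm x.
Proof.
suff /choice[L hL] : forall x, exists l, forall n,
    nrm (l - Y n x) <= (1 - c n) * nrm x.
  by exists L => n x; exact: hL.
move=> x; have dist n m : (n <= m)%N -> nrm (Y m x - Y n x) <= (1 - c n) * nrm x.
  move=> nm; apply: le_trans (sqrt_iter_cauchy x nm) _.
  apply: ler_wpM2r; first exact: nrm_ge0.
  by have [_ h _] := sqrt_radius_bounds m; lra.
have hc : gcauchy g (fun n => Y n x).
  move=> e e0; have p : 0 < 2 * (nrm x + 1) by have := nrm_ge0 g x; lra.
  have [N hN] := sqrt_radius_cvg (divr_gt0 e0 p); exists N => m n hm hn.
  apply: le_lt_trans (nrmB_le hh _ (Y N x) _) _; rewrite (nrmBC hh (Y N x)).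
  have h1 := dist _ _ hm; have h2 := dist _ _ hn.
  have := hN N (leqnn N); rewrite ltr_pdivlMr// => h3.
  have [_ h4 _] := sqrt_radius_bounds N; lra.
have [l hl] := nrm_cauchy hh hc; exists l => n; apply/ler_addgt0Pr => d d0.
have [N hN] := hl d d0.
apply: le_trans (nrmB_le hh _ (Y (maxn n N) x) _) _.
have := hN _ (leq_maxr n N); rewrite (nrmBC hh l) => h1.
by have := dist _ _ (leq_maxl n N); lra.
Qed.

Lemma sqrt_iter_commute X n : linear X -> X \o A = A \o X ->
  forall x, X (Y n x) = Y n (X x).
Proof.
move=> lX hX; elim: n => [|n ih] x /=; first by rewrite lin0.
rewrite linZ// linD// -[X (A x)]/((X \o A) x) hX /=; congr (_ *: (_ + _)).
by rewrite !ih.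
Qed.

Lemma sqrt_iter_sym n : (forall x y, re (A x) y = re x (A y)) ->
  forall x y, re (Y n x) y = re x (Y n y).
Proof.
move=> sA; elim: n => [|n ih] x y /=; first by rewrite !(reE hg).
by rewrite !(reE hg) sA !ih.
Qed.

Section Limit.
Context (L : H -> H) (hL : forall n x, nrm (L x - Y n x) <= (1 - c n) * nrm x).

Lemma limit_contraction x : nrm (L x) <= nrm x.
Proof. by have := hL 0 x; rewrite /= !subr0 mul1r. Qed.

Lemma eq_limit x y (b : R) : 0 <= b ->
  (forall n, nrm (x - y) <= (1 - c n) * b) -> x = y.
Proof.
move=> b0 h; apply/eqP; rewrite -subr_eq0; apply/eqP/(nrm_eq0 hh)/eqP.
by rewrite eq_le nrm_ge0 andbT; exact: sqrt_radius_small b0 h.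
Qed.

Lemma limit_linear : linear L.
Proof.
move=> a x y; set d := `|complex.Re a| + `|complex.Im a|.
have d0 : 0 <= d by rewrite addr_ge0.
apply: (@eq_limit _ _ (nrm (a *: x + y) + (d * nrm x + nrm y))).
  by rewrite !addr_ge0 ?mulr_ge0 ?nrm_ge0.
move=> n; apply: le_trans (nrmB_le hh _ (Y n (a *: x + y)) _) _.
rewrite {2}sqrt_iter_linear opprD addrACA -scalerBr mulrDr mulrDr.
apply: lerD; first exact: hL; apply: le_trans (nrmD hh _ _) _.
apply: lerD; last by rewrite (nrmBC hh); exact: hL.
apply: le_trans (nrmZ_le hh _ _) _; rewrite -/d mulrCA.
by apply: ler_wpM2l => //; rewrite (nrmBC hh); exact: hL.
Qed.

Lemma limit_eq x : L x + L x = A x + L (L x).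
Proof.
apply: (@eq_limit _ _ (4 * nrm x)); first by rewrite mulr_ge0 ?nrm_ge0.
move=> n.
have e : Y n.+1 x + Y n.+1 x = A x + Y n (Y n x).
  by rewrite /= -scalerDl -[RHS]scale1r; congr (_ *: _); apply: complexP => /=; lra.
apply: le_trans (nrmB_le hh _ (Y n.+1 x + Y n.+1 x) _) _.
rewrite {2}e !opprD addrACA [in X in _ + X](addrACA (A x)) subrr add0r.
have h1 := hL n.+1 x; have h2 := nrmD hh (L x - Y n.+1 x) (L x - Y n.+1 x).
have h3 := nrmB_le hh (Y n (Y n x)) (Y n (L x)) (L (L x)).
rewrite -(linB (sqrt_iter_linear n)) (nrmBC hh (Y n (L x))) in h3.
have h4 := sqrt_iter_bound n (Y n x - L x); rewrite (nrmBC hh (Y n x)) in h4 h3.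
have h5 := hL n (L x); have h6 := limit_contraction x; have h7 := hL n x.
have [c0 c1 _] := sqrt_radius_bounds n.
have c2 := sqrt_radius_mono (leqnSn n).
have h8 : c n * nrm (L x - Y n x) <= nrm (L x - Y n x).
  by apply: ler_piMl => //; exact: nrm_ge0.
have h9 : (1 - c n) * nrm (L x) <= (1 - c n) * nrm x by apply: ler_wpM2l; lra.
have h10 : (1 - c n.+1) * nrm x <= (1 - c n) * nrm x.
  by apply: ler_wpM2r; [exact: nrm_ge0|lra].
by rewrite (nrmBC hh (Y n (Y n x))) in h3 *; lra.
Qed.

Lemma limit_sym : (forall x y, re (A x) y = re x (A y)) ->
  forall x y, re (L x) y = re x (L y).
Proof.
move=> sA; suff le_sym x y : re (L x) y - re x (L y) <= 0.
  move=> x y; apply/eqP; rewrite eq_le -subr_le0 le_sym /=.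
  by rewrite -subr_le0 (reC hg x) (reC hg _ y) le_sym.
apply: (@sqrt_radius_small _ (2 * (nrm x * nrm y))).
  by rewrite !mulr_ge0 ?nrm_ge0.
move=> n; have h1 := abs_re_le hh (L x - Y n x) y.
have h2 := abs_re_le hh x (L y - Y n y).
have h3 : nrm (L x - Y n x) * nrm y <= (1 - c n) * nrm x * nrm y.
  by apply: ler_wpM2r; [exact: nrm_ge0|exact: hL].
have h4 : nrm x * nrm (L y - Y n y) <= nrm x * ((1 - c n) * nrm y).
  by apply: ler_wpM2l; [exact: nrm_ge0|exact: hL].
move: h1 h2; rewrite !ler_norml !(reE hg) sqrt_iter_sym// => /andP[? ?] /andP[? ?].
by lra.
Qed.

Lemma limit_commute X : bounded_op g X -> X \o A = A \o X ->
  forall x, X (L x) = L (X x).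
Proof.
move=> bX hX x; have [M M0 hM] := bounded_nonneg bX; have lX := bX.1.
apply: (@eq_limit _ _ (M * nrm x + nrm (X x))).
  by rewrite addr_ge0 ?mulr_ge0 ?nrm_ge0.
move=> n; apply: le_trans (nrmB_le hh _ (X (Y n x)) _) _; rewrite mulrDr.
apply: lerD; last by rewrite sqrt_iter_commute// (nrmBC hh); exact: hL.
rewrite -linB//; apply: le_trans (hM _) _; rewrite mulrCA.
by apply: ler_wpM2l => //; exact: hL.
Qed.

End Limit.
End Iteration.

(** For [m] above a bound of [T], [A = 1 - T / m] is a contraction because [T^2 <= m T]. The limit
    [L] of the iteration solves [(1 - L)^2 = T / m], so [Q] is [1 - L] times the root of [m].
    Operators commuting with [T] commute with each iterate, hence with [L]. *)
Lemma sqrt_op_exists T : positive_op g T -> exists2 Q, is_sqrt_op g T Q &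
  forall X, bounded_op g X -> X \o T = T \o X -> X \o Q = Q \o X.
Proof.
move=> pT; have lT := pT.1.1; have [M M0 hM] := bounded_nonneg pT.1.
pose m := M + 1; have m0 : 0 < m by rewrite /m; lra.
have hm x : re (T x) (T x) <= m * re (T x) x.
  apply: positive_sqr_le; rewrite ?ltW// => y; apply: le_trans (hM y) _.
  by apply: ler_wpM2r; [exact: nrm_ge0|rewrite /m; lra].
pose A x := x - (m^-1)%:C *: T x.
have lA : linear A.
  move=> a x y; rewrite /A lT scalerDr scalerBr !scalerA mulrC opprD !addrA.
  by congr (_ + _); rewrite addrAC.
have sT x y : re (T x) y = re x (T y) by exact: adjoint_reform (positive_sym pT).
have sA x y : re (A x) y = re x (A y) by rewrite /A !(reE hg) sT.
have hA x : nrm (A x) <= nrm x.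
  rewrite -(@ler_pXn2r _ 2) ?nnegrE ?nrm_ge0// !(nrm_sqr hh) /A !(reE hg).
  rewrite -(sT x x); have := hm x; set a := re (T x) (T x); set b := re (T x) x.
  move=> ab; have b0 : 0 <= b by exact: positive_re.
  have h : m^-1 * (m^-1 * a) <= m^-1 * b.
    by rewrite ler_pM2l ?invr_gt0// ler_pdivrMl.
  have h' : 0 <= m^-1 * b by rewrite mulr_ge0// invr_ge0 ltW.
  by lra.
have [L hL] := sqrt_iter_limit lA hA.
have lL := limit_linear lA hL; have sL := limit_sym hL sA.
pose Q x := (Num.sqrt m)%:C *: (x - L x).
have lQ : linear Q.
  move=> a x y; rewrite /Q lL scalerA mulrC -scalerA -scalerDr; congr (_ *: _).
  by rewrite scalerBr opprD !addrA; congr (_ + _); rewrite addrAC.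
exists Q; first split.
- apply: symmetric_positive => // [x y|x]; first by rewrite /Q !(reE hg) sL.
  rewrite /Q !(reE hg) mulr_ge0 ?sqrtr_ge0// subr_ge0 -(nrm_sqr hh) expr2.
  apply: le_trans (re_le hh _ _) _; apply: ler_wpM2r; first exact: nrm_ge0.
  exact: (limit_contraction hL).
- apply/funext => x; rewrite /Q /= (linZ lL) -scalerBr scalerA (linB lL).
  have -> : x - L x - (L x - L (L x)) = (m^-1)%:C *: T x.
    have := limit_eq lA hA hL x; rewrite /A => e.
    by rewrite opprB addrACA -opprD e [in X in - X]addrAC opprB addrC subrK.
  rewrite scalerA -!rmorphM /= -expr2 sqr_sqrtr ?ltW// divff ?gt_eqF//.
  exact: scale1r.
move=> X bX hX; have lX := bX.1; apply/funext => x; rewrite /Q /= linZ// linB//.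
congr (_ *: (_ - _)); apply: (limit_commute hL) => //.
apply/funext => y; rewrite /A /= linB// linZ//; congr (_ - _ *: _).
exact: (congr1 (@^~ y) hX).
Qed.

(** By uniqueness of the positive root: [Q] commutes with [T], hence with the constructed [Q0], so
    [(Q + Q0) y = 0] for [y = Q x - Q0 x]. Positivity gives [Q y = Q0 y = 0], and then
    [<y, y> = 0]. *)
Lemma sqrt_op_commute T Q X : is_sqrt_op g T Q -> bounded_op g X ->
  X \o T = T \o X -> X \o Q = Q \o X.
Proof.
move=> [pQ QT] bX hX; have sQ := positive_sym pQ; have lQ := pQ.1.1.
have pT : positive_op g T.
  apply: symmetric_positive; rewrite -QT.
  - exact: linear_comp.
  - by move=> x y /=; rewrite !(adjoint_reform _ _ sQ).
  - by move=> x /=; rewrite (adjoint_reform _ _ sQ); exact: hilbert_ge0.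
have [Q0 [pQ0 Q0T] hQ0] := sqrt_op_exists pT.
suff -> : Q = Q0 by exact: hQ0.
have QQ0 x : Q (Q0 x) = Q0 (Q x).
  by apply: (congr1 (@^~ x) (hQ0 Q pQ.1 _)); rewrite -QT.
apply/funext => x; apply/eqP; rewrite -subr_eq0; apply/eqP.
have [y ey] : exists y, y = Q x - Q0 x by exists (Q x - Q0 x).
rewrite -ey.
have lQ0 := pQ0.1.1; have sQ0 := positive_sym pQ0.
have e : Q y + Q0 y = 0.
  rewrite ey (linB lQ) (linB lQ0) QQ0 addrA subrK.
  by rewrite -[Q (Q x)]/((Q \o Q) x) -[Q0 (Q0 x)]/((Q0 \o Q0) x) QT Q0T subrr.
have e1 : re (Q y) y + re (Q0 y) y = 0 by rewrite -(reDl hg) e (re0l hg).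
have p1 := positive_re y pQ; have p2 := positive_re y pQ0.
have z1 : Q y = 0 by apply: positive_eq0 => //; lra.
have z2 : Q0 y = 0 by apply: positive_eq0 => //; lra.
apply: (hilbert_eq0 hh); rewrite {1}ey !(reE hg).
by rewrite (adjoint_reform _ _ sQ) (adjoint_reform _ _ sQ0) z1 z2 !(re0r hg) subrr.
Qed.

End SquareRoots.

(** * Signature operators *)

Section Signatures.
Context {R : realType} {H : lmodType R[i]}.
Context (ip : {hermitian_sym H for Num.conj}).
Local Notation rip := (reform ip).
Implicit Types (J T Ts V X : H -> H) (M : set H).

Lemma krein_form : hermitian_form ip.
Proof.
split=> [a x y z|x y]; first by rewrite linearDl linearZl_LR.
by rewrite hermC expr0 mul1r.
Qed.
Local Notation hip := krein_form.

Lemma signature_decomposition J : is_signature ip J ->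
  exists Hp Hm Pp Pm, [/\ fundamental_decomposition ip Hp Hm,
    [/\ linear Pp, linear Pm, (forall x, Hp (Pp x)) & forall x, Hm (Pm x)],
    [/\ forall x, Hp x -> Pp x = x, forall x, Hp x -> Pm x = 0,
        forall x, Hm x -> Pm x = x & forall x, Hm x -> Pp x = 0],
    (forall x, x = Pp x + Pm x) & forall x, J x = Pp x - Pm x].
Proof.
move=> [Hp [Hm [Pp [Pm [fd [lp ip' rp np] [lm im rm nm] ->]]]]].
exists Hp, Hm, Pp, Pm.
have hp x : Hp (Pp x) by rewrite -rp; exists x.
have hm x : Hm (Pm x) by rewrite -rm; exists x.
have pp x : Hp x -> Pp x = x.
  by rewrite -rp => -[y _ <-]; exact: (congr1 (@^~ y) ip').
have mm x : Hm x -> Pm x = x.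
  by rewrite -rm => -[y _ <-]; exact: (congr1 (@^~ y) im).
have pm x : Hp x -> Pm x = 0 by rewrite -nm.
have mp x : Hm x -> Pp x = 0 by rewrite -np.
split=> // x; have [[ds _] _ _ _] := fd.
have : setT x by []; rewrite -ds => -[a ha [b hb <-]].
by rewrite (linD lp) (linD lm) (pp a ha) (mp b hb) (pm a ha) (mm b hb) addr0 add0r.
Qed.

Lemma cauchy_sub (g1 g2 : H -> H -> R[i]) P (x : nat -> H) : linear P ->
  (forall y, gnorm g1 (P y) <= gnorm g2 y) -> gcauchy g2 x -> gcauchy g1 (P \o x).
Proof.
move=> lP h hx e e0; have [N hN] := hx e e0; exists N => m n hm hn /=.
by rewrite -(linB lP); apply: le_lt_trans (h _) _; exact: hN.
Qed.

(** In components, [hilbert_ip ip J x y] is [[Pp x, Pp y] - [Pm x, Pm y]], an orthogonal sum of two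
    Hilbert spaces; completeness is checked on each of them. *)
Lemma signature_hilbert J : is_signature ip J ->
  [/\ linear J, forall x, J (J x) = x, adjoint_of ip J J
    & hilbert (hilbert_ip ip J)].
Proof.
move=> /signature_decomposition[Hp [Hm [Pp [Pm [[_ orth
  [sp pos_p def_p comp_p _] [sm pos_m def_m comp_m _]]
  [lp lm hp hm] [pp pm mm mp] dec eJ]]]]].
have Pp0 := lin0 lp; have Pm0 := lin0 lm.
have lJ : linear J.
  by have -> : J = Pp \- Pm; [apply/funext => x; exact: eJ|exact: linear_sub].
have JJ x : J (J x) = x.
  rewrite !eJ (linB lp) (linB lm) (pp _ (hp x)) (mp _ (hm x)) (pm _ (hp x)).
  rewrite (mm _ (hm x)) subr0 sub0r opprK.
  by rewrite -dec.
have c1 x y : Hp x -> Hm y -> ip x y = 0 by exact: orth.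
have c2 x y : Hm x -> Hp y -> ip x y = 0.
  by move=> hx hy; rewrite hip.2 c1// rmorph0.
have er x y : rip x y = rip (Pp x) (Pp y) + rip (Pm x) (Pm y).
  rewrite {1}(dec x) {1}(dec y) !(reE hip).
  by rewrite /reform (c1 _ _ (hp x) (hm y)) (c2 _ _ (hm x) (hp y)) /=; lra.
have pJ x : Pp (J x) = Pp x by rewrite eJ (linB lp) (pp _ (hp x)) (mp _ (hm x)) subr0.
have mJ x : Pm (J x) = - Pm x by rewrite eJ (linB lm) (pm _ (hp x)) (mm _ (hm x)) sub0r.
have aJ : adjoint_of ip J J.
  apply: (adjoint_re hip) => // x y.
  by rewrite (er (J x)) (er x) !pJ !mJ (reNl hip) (reNr hip).
have eg x y : reform (hilbert_ip ip J) x y = rip (Pp x) (Pp y) - rip (Pm x) (Pm y).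
  by rewrite /reform /hilbert_ip -!/(reform ip _ _) er pJ mJ (reNl hip).
have hg : hermitian_form (hilbert_ip ip J) by exact: (hermitian_op hip lJ aJ).
have gp x : 0 <= rip (Pp x) (Pp x) by rewrite -(form_ge0 hip); exact: pos_p.
have gm x : rip (Pm x) (Pm x) <= 0.
  by rewrite -(form_le0 hip) -oppr_ge0; exact: pos_m.
have np x : gnorm ip (Pp x) <= gnorm (hilbert_ip ip J) x.
  by rewrite /gnorm -!/(reform _ _ _) eg ler_wsqrtr//; have := gm x; lra.
pose im := fun x y => - ip x y.
have eim x : reform im x x = - rip x x by rewrite /reform /im; case: (ip x x).
have nm x : gnorm im (Pm x) <= gnorm (hilbert_ip ip J) x.
  by rewrite /gnorm -!/(reform _ _ _) eg eim ler_wsqrtr//; have := gp x; lra.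
split=> //; split=> //.
- by move=> x; rewrite eg; have := gp x; have := gm x; lra.
- move=> x; rewrite eg => h; have := gp x; have := gm x => h1 h2.
  have zp : Pp x = 0.
    apply: def_p => //; apply: complexP; last by rewrite (Im_form_self hip).
    by rewrite /= -/(reform ip _ _); lra.
  have zm : Pm x = 0.
    apply: def_m => //; apply: complexP.
      by rewrite -/(reform im _ _) eim /=; lra.
    have := Im_form_self hip (Pm x).
    by case: (ip (Pm x) (Pm x)) => a b /= ->; rewrite oppr0.
  by rewrite (dec x) zp zm addr0.
move=> x _ hx.
have [|l1 hl1 cl1] := comp_p (Pp \o x) _ (cauchy_sub lp np hx).
  by move=> n; exact: hp.
have [|l2 hl2 cl2] := comp_m (Pm \o x) _ (cauchy_sub lm nm hx).
  by move=> n; exact: hm.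
exists (l1 + l2) => //; apply/cvgrPdist_lt => e e0.
have e2 : 0 < e / 2 by rewrite divr_gt0.
move/cvgrPdist_lt : cl1 => /(_ _ e2) [N1 _ h1].
move/cvgrPdist_lt : cl2 => /(_ _ e2) [N2 _ h2].
exists (maxn N1 N2) => // n; rewrite /= geq_max => /andP[n1 n2].
have := h1 n n1; have := h2 n n2.
rewrite /= !sub0r !normrN !ger0_norm ?sqrtr_ge0//.
rewrite -/im /gnorm -!/(reform _ _ _) => a2 a1.
rewrite eg !(linB lp) !(linB lm) !(linD lp) !(linD lm) (pp l1 hl1) (mm l2 hl2).
rewrite (mp l2 hl2) (pm l1 hl1) addr0 add0r.
rewrite eim in a2.
set A := rip _ _ in a1 *; set B := rip _ _ in a2 *.
have A0 : 0 <= A by rewrite /A -{1 2}(pp l1 hl1) -(linB lp); exact: gp.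
have B0 : 0 <= - B by rewrite oppr_ge0 /B -{1 2}(mm l2 hl2) -(linB lm); exact: gm.
apply: le_lt_trans (_ : Num.sqrt A + Num.sqrt (- B) < _); last by lra.
rewrite -(@ler_pXn2r _ 2) ?nnegrE ?addr_ge0 ?sqrtr_ge0//.
rewrite sqrrD !sqr_sqrtr//; last by lra.
by have := mulr_ge0 (sqrtr_ge0 A) (sqrtr_ge0 (- B)); lra.
Qed.

Section Signature.
Context J (hJ : is_signature ip J).
Local Notation g := (hilbert_ip ip J).

Lemma signature_linear : linear J.
Proof. by have [] := signature_hilbert hJ. Qed.

Lemma signatureK x : J (J x) = x.
Proof. by have [_ h] := signature_hilbert hJ. Qed.

Lemma signature_adjoint : adjoint_of ip J J.
Proof. by have [_ _ h] := signature_hilbert hJ. Qed.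

Lemma hilbert_signature : hilbert g.
Proof. by have [_ _ _ h] := signature_hilbert hJ. Qed.

Lemma hilbert_ipJ x y : g (J x) y = ip x y.
Proof. by rewrite /hilbert_ip signatureK. Qed.

Lemma hilbert_ipr x y : g x (J y) = ip x y.
Proof. by rewrite /hilbert_ip -signature_adjoint signatureK. Qed.

Lemma ip_adjoint_hilbert T Ts : adjoint_of ip T Ts -> adjoint_of g T (J \o Ts \o J).
Proof.
move=> h x y /=; rewrite hilbert_ipr -h; exact: signature_adjoint.
Qed.

Lemma hilbert_adjoint_ip T Ts : adjoint_of g T Ts -> adjoint_of ip T (J \o Ts \o J).
Proof. by move=> h x y /=; rewrite -hilbert_ipr h; exact: signature_adjoint. Qed.

Lemma krein_adjoint_op T : adjoint_of ip T T -> adjoint_of g (J \o T) (J \o T).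
Proof. by move=> h x y /=; rewrite hilbert_ipr hilbert_ipJ. Qed.

Lemma krein_inj x y : (forall z, rip x z = rip y z) -> x = y.
Proof.
move=> h; rewrite -[x]signatureK -[y]signatureK; congr J.
apply: (re_inj hilbert_signature) => z; rewrite !(reC (hilbert_form hilbert_signature) z).
by rewrite /reform !hilbert_ipJ; exact: h.
Qed.

End Signature.

(** Boundedness for every signature operator follows from the adjoint relation by
    Hellinger-Toeplitz. *)
Lemma krein_selfadjointP T : linear T -> adjoint_of ip T T -> krein_selfadjoint ip T.
Proof.
move=> lT aT; split=> //; split=> // J hJ.
exact: (hellinger_toeplitz (hilbert_signature hJ) (ip_adjoint_hilbert hJ aT)).
Qed.

Lemma krein_leP T1 T2 : krein_selfadjoint ip T1 -> krein_selfadjoint ip T2 ->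
  (forall x, rip (T1 x) x <= rip (T2 x) x) -> krein_le ip T1 T2.
Proof.
move=> [[l1 _] a1] [[l2 _] a2] h x; have l := linear_sub l2 l1.
rewrite (form_ge0 (hermitian_op hip l _)); last first.
  by apply: (adjoint_re hip) => // y z; rewrite !(reE hip) /reform a1 a2.
by rewrite /reform -!/(reform _ _ _) (reE hip) (reE hip) subr_ge0; exact: h.
Qed.

Lemma krein_le_re T1 T2 x : krein_le ip T1 T2 -> rip (T1 x) x <= rip (T2 x) x.
Proof.
move=> /(_ x); rewrite lecE => /andP[_ /=].
by rewrite -/(rip _ _) !(reE hip) subr_ge0.
Qed.

Lemma krein_opp (V : H -> H) : krein_selfadjoint ip V -> krein_selfadjoint ip (fun x => - V x).
Proof.
move=> [[lV _] aV]; have lN : linear (fun x => - V x).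
  by move=> c x y; rewrite lV opprD scalerN.
apply: krein_selfadjointP => //; apply: (adjoint_re hip) => // x y.
by rewrite !(reE hip) /reform aV.
Qed.

Lemma krein_sub (V X : H -> H) : krein_selfadjoint ip V -> krein_selfadjoint ip X ->
  krein_selfadjoint ip (V \- X).
Proof.
move=> [[lV _] aV] [[lX _] aX]; have lN := linear_sub lV lX.
apply: krein_selfadjointP => //; apply: (adjoint_re hip) => // x y.
by rewrite !(reE hip) /reform aV aX.
Qed.

Lemma krein_le_opp T1 T2 : krein_le ip T1 T2 ->
  krein_le ip (fun x => - T2 x) (fun x => - T1 x).
Proof. by move=> h x; have := h x; rewrite /= opprK addrC. Qed.

Lemma orthocompl_opp M T : range T `<=` orthocompl ip M ->
  range (fun x => - T x) `<=` orthocompl ip M.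
Proof.
move=> h _ [x _ <-] s hs; rewrite -scaleN1r (formZl hip).
by rewrite (h (T x)) ?mulr0//; exists x.
Qed.

(** Negation reverses the order and keeps the range condition, so results on minima are deduced from
    those on maxima. *)
Lemma Nminus_opp V X M : Nplus ip V (orthocompl ip M) X ->
  Nminus ip (fun x => - V x) (orthocompl ip M) (fun x => - X x).
Proof.
move=> [sX leX rX].
by split; [exact: krein_opp|exact: krein_le_opp|exact: orthocompl_opp].
Qed.

Lemma Nplus_opp V X M : Nminus ip V (orthocompl ip M) X ->
  Nplus ip (fun x => - V x) (orthocompl ip M) (fun x => - X x).
Proof.
move=> [sX leX rX].
by split; [exact: krein_opp|exact: krein_le_opp|exact: orthocompl_opp].
Qed.

Lemma min_Nplus M V X : is_max ip (Nminus ip V (orthocompl ip M)) X ->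
  is_min ip (Nplus ip (fun x => - V x) (orthocompl ip M)) (fun x => - X x).
Proof.
move=> [NX hX]; split; first exact: Nplus_opp.
have oppK T : (fun x => - (- T x)) = T by apply/funext => x; exact: opprK.
move=> Y /Nminus_opp; rewrite oppK => /hX /krein_le_opp; rewrite oppK; exact.
Qed.

End Signatures.

(** * One-sided extrema *)

Section OneStep.
Context {R : realType} {H : lmodType R[i]}.
Context (ip : {hermitian_sym H for Num.conj}).
Context (J : H -> H) (hJ : is_signature ip J).
Local Notation hip := (krein_form ip).
Local Notation rip := (reform ip).
Local Notation g := (hilbert_ip ip J).
Local Notation hh := (hilbert_signature hJ).
Local Notation hg := (hilbert_form hh).
Local Notation re := (reform g).
Local Notation nrm := (gnorm g).
Implicit Types (V W X Y q f fs : H -> H) (M S : set H).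

(* When [|q s|^2 = [W s, s]] on [M], this is the range condition of weak
   complementability in the variational form given by Douglas' lemma. *)
Definition dominated M q W : Prop :=
  forall y, exists C : R, forall s, M s -> rip (W s) y <= C * nrm (q s).

(** Variational counterpart of the reduced solution: the closure condition singles out one
    representative of [s |-> [W s, y]]. *)
Definition reduced_map M q W f : Prop :=
  [/\ exists fs, adjoint_of g f fs, forall y, gclosure g (q @` M) (f y)
    & forall s y, M s -> g (q s) (f y) = ip (W s) y].

(** [Phi] is [J f^* f], with the adjoint taken in the Hilbert space of [J]. *)
Definition gram f Phi : Prop := krein_selfadjoint ip Phi /\
  forall x y, ip (Phi x) y = g (f x) (f y).

Lemma reduced_map_exists M q W : subspace M -> linear q -> linear W ->
  dominated M q W -> exists f, reduced_map M q W f.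
Proof.
move=> sM lq lW hd.
have lJW : linear (J \o W) := linear_comp (signature_linear hJ) lW.
have [|f [fs [h1 h2 h3]]] := douglas hh sM lq lJW.
  move=> y; have [C hC] := hd y; exists C => s hs.
  by rewrite /reform (hilbert_ipJ hJ); exact: hC.
by exists f; split=> // [|s y hs]; [exists fs|rewrite h3// (hilbert_ipJ hJ)].
Qed.

Lemma gram_exists M q W f : reduced_map M q W f -> exists Phi, gram f Phi.
Proof.
move=> [[fs hfs] _ _].
have hP x y : ip ((J \o fs \o f) x) y = g (f x) (f y).
  by rewrite /= -(adjoint_sym hh hfs); reflexivity.
have lf := adjoint_linear hh hfs.
have lfs := adjoint_linear hh (adjoint_sym hh hfs).
have lP : linear (J \o fs \o f).
  apply: linear_comp => //; apply: linear_comp => //; exact: (signature_linear hJ).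
exists (J \o fs \o f); split=> //; apply: krein_selfadjointP => // x y.
by rewrite hP (hip.2 x) hP; exact: hg.2.
Qed.

Lemma reduced_map_eq0 M q W f y : subspace M -> linear q -> reduced_map M q W f ->
  (forall s, M s -> rip (W s) y = 0) -> f y = 0.
Proof.
move=> sM lq [_ cf hf] h; apply: (gclosure_perp_eq0 hh (subspace_image lq sM)) => //.
by move=> _ [s hs <-]; rewrite /reform hf//; exact: h.
Qed.

(* [X y y] is at most [V (y - s) (y - s) = (V - Phi) y y + |f y - q s|^2]
   for every [s] in [M], and the last term can be made arbitrarily small. *)
Lemma max_Nminus M q V f Phi : subspace M -> linear q -> krein_selfadjoint ip V ->
  (forall s t, M s -> M t -> re (q s) (q t) = rip (V s) t) ->
  reduced_map M q V f -> gram f Phi ->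
  is_max ip (Nminus ip V (orthocompl ip M)) (V \- Phi).
Proof.
move=> sM lq sV hq rf [sP hP]; have [[fs hfs] cf hf] := rf.
have hfre s y : M s -> re (q s) (f y) = rip (V s) y.
  by move=> hs; rewrite /reform hf.
have [[lV _] aV] := sV.
have sVP := krein_sub sV sP.
(* Both vectors lie in the closure of [q M] and represent [t |-> [V t, s]]. *)
have fq s : M s -> f s = q s.
  move=> hs; apply/eqP; rewrite -subr_eq0; apply/eqP.
  have sqM := subspace_image lq sM; have scl := subspace_gclosure hh sqM.
  apply: (gclosure_perp_eq0 hh sqM).
    by apply: (subB scl) => //; apply: (gclosure_sub hh); exists s.
  by move=> _ [t ht <-]; rewrite !(reE hg) hq// hfre// subrr.
have hPre x y : rip (Phi x) y = re (f x) (f y) by rewrite /reform hP.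
split; first split=> //.
- apply: krein_leP => // x /=; rewrite !(reE hip) hPre.
  by have := hilbert_ge0 hh (f x); lra.
- move=> _ [x _ <-] s hs /=.
  rewrite (formDl hip) -scaleN1r (formZl hip) mulN1r hP (fq s hs) aV.
  by rewrite (hip.2 x) (hg.2 (f x)) hf// subrr.
move=> Y [sY leY rY]; apply: krein_leP => // x /=.
have [[lY _] aY] := sY.
rewrite !(reE hip) hPre -subr_ge0 -oppr_le0.
apply: (@le0_small _ _ 1) => e e0; rewrite mulr1.
have [_ [s hs <-] hlt] := cf x (Num.sqrt e) ltac:(by rewrite sqrtr_gt0).
have h1 : re (f x - q s) (f x - q s) <= e.
  have e1 := ltW e0; rewrite -(nrm_sqr hh) -[leRHS]sqr_sqrtr//.
  by rewrite ler_pXn2r ?nnegrE ?nrm_ge0 ?sqrtr_ge0// ltW.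
(* [Y] is selfadjoint with range orthogonal to [M], so every term containing [s] drops out of
   [[Y (x - s), x - s]]. *)
have Y0 u : rip (Y u) s = 0 by rewrite /reform (rY (Y u))//; exists u.
have Ys : rip (Y s) x = 0 by rewrite (adjoint_reform _ _ aY) (reC hip) Y0.
have := krein_le_re (x - s) leY.
rewrite !(linB lY, linB lV) !(reE hip) !Y0 Ys.
have -> : rip (V x) s = re (q s) (f x).
  by rewrite (adjoint_reform _ _ aV) (reC hip) (hfre s).
have -> : rip (V s) x = re (q s) (f x) by rewrite (hfre s).
rewrite -(hq s s hs hs).
by move: h1; rewrite !(reE hg) (reC hg (f x) (q s)); lra.
Qed.

(** [X] annihilates [M], so for [s] in [M] the form of [W - X] takes the values [[W s, y]] at
    [(s, y)] and [|q s|^2] at [(s, s)]; Cauchy-Schwarz concludes. *)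
Lemma dominated_Nminus M q W X : linear q -> krein_selfadjoint ip W ->
  (forall s, M s -> re (q s) (q s) = rip (W s) s) ->
  Nminus ip W (orthocompl ip M) X -> dominated M q W.
Proof.
move=> lq [[lW _] aW] hq [[[lX _] aX] leX rX] y.
have X0 s u : M s -> rip (X s) u = 0.
  move=> hs; rewrite (adjoint_reform _ _ aX) (reC hip) /reform.
  by have -> : ip (X u) s = 0 by apply: rX.
exists (Num.sqrt (rip (W y) y - rip (X y) y)) => s hs.
have lD := linear_sub lW lX.
have aD : adjoint_of ip (W \- X) (W \- X).
  by apply: (adjoint_re hip) => // a b; rewrite !(reE hip) /reform aW aX.
have hD := hermitian_op hip lD aD.
have pD z : 0 <= reform (fun x y => ip ((W \- X) x) y) z z.
  by rewrite -(form_ge0 hD); exact: leX.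
have := semidefinite_CS s y hD pD; have := pD y.
rewrite /reform /= -!/(rip _ _) !(reE hip) !(X0 s _ hs) -(hq s hs).
rewrite -(nrm_sqr hh) !subr0 => h0 h.
apply: le_trans (ler_norm _) _.
rewrite -(@ler_pXn2r _ 2) ?nnegrE ?mulr_ge0 ?sqrtr_ge0 ?nrm_ge0//.
by rewrite real_normK ?num_real// exprMn sqr_sqrtr// mulrC.
Qed.

End OneStep.

(** * The growth argument behind Reid's inequality *)

Section Reid.
Context {R : realType}.

(** If [r 0] exceeded [M * a], the recursion would force [r k] above [a * (x * M) ^+ (2 ^ k)] with
    [x > 1], against the second bound. *)
Lemma iterated_square_le (r : nat -> R) (a D M : R) : 0 <= a -> 0 < M ->
  (forall k, r k ^+ 2 <= r k.+1 * a) -> (forall k, r k <= D * M ^+ (2 ^ k)) ->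
  r 0%N <= M * a.
Proof.
move=> a0 M0 hr hD; have [z|an0] := eqVneq a 0.
  have := hr 0%N; rewrite z mulr0 mulr0 => h.
  suff -> : r 0%N = 0 by [].
  by apply/eqP; rewrite -sqrf_eq0 eq_le h sqr_ge0.
have ap : 0 < a by rewrite lt_neqAle eq_sym an0.
rewrite leNgt; apply/negP => hlt; set x := r 0%N / (M * a).
have x1 : 1 < x by rewrite /x ltr_pdivlMr ?mul1r ?mulr_gt0.
have grow k : a * (x * M) ^+ (2 ^ k) <= r k.
  elim: k => [|k ih].
    by rewrite expn0 expr1 /x le_eqVlt; apply/orP; left; apply/eqP; field; rewrite !gt_eqF.
  have p0 : 0 <= a * (x * M) ^+ (2 ^ k).
    by rewrite mulr_ge0// exprn_ge0// mulr_ge0 ?ltW//; lra.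
  rewrite -(ler_pM2r ap); apply: le_trans (hr k).
  rewrite expnS mulnC exprM -mulrA [X in a * X]mulrC mulrA -expr2 -exprMn.
  by rewrite ler_pXn2r// nnegrE//; exact: le_trans ih.
(* After division by [M ^+ (2 ^ k)], Bernoulli's inequality and [k <= 2 ^ k] leave a bounded
   quantity that is linear in [k]. *)
have bound k : a * (1 + k%:R * (x - 1)) <= D.
  have Mp : 0 < M ^+ (2 ^ k) by rewrite exprn_gt0.
  rewrite -(ler_pM2r Mp); apply: le_trans (hD k); apply: le_trans (grow k).
  rewrite exprMn mulrA ler_pM2r// ler_pM2l//.
  have bern m : 1 + m%:R * (x - 1) <= x ^+ m.
    elim: m => [|m ih]; first by rewrite mul0r addr0 expr0.
    rewrite exprS -natr1; apply: (@le_trans _ _ (x * (1 + m%:R * (x - 1)))).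
      have m0 : 0 <= m%:R :> R by [].
      have := mulr_ge0 m0 (sqr_ge0 (x - 1)); nra.
    by apply: ler_wpM2l => //; lra.
  apply: le_trans (bern _); rewrite lerD2l ler_wpM2r//; first by lra.
  by rewrite ler_nat ltnW// ltn_expl.
pose k := Num.bound (`|D| / (a * (x - 1))).
have d0 : 0 < a * (x - 1) by rewrite mulr_gt0//; lra.
have h1 : `|D| / (a * (x - 1)) < k%:R.
  by apply: archi_boundP; rewrite divr_ge0// ltW.
rewrite ltr_pdivrMr// in h1; have := bound k; have := ler_norm D; nra.
Qed.

End Reid.

(** * Schur complements for an arbitrary signature operator *)

Section SchurData.
Context {R : realType} {H : lmodType R[i]}.
Context (ip : {hermitian_sym H for Num.conj}).
Context (J : H -> H) (hJ : is_signature ip J).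
Local Notation hip := (krein_form ip).
Local Notation rip := (reform ip).
Local Notation g := (hilbert_ip ip J).
Local Notation hh := (hilbert_signature hJ).
Local Notation hg := (hilbert_form hh).
Local Notation re := (reform g).
Local Notation nrm := (gnorm g).

Context (W : H -> H) (lW : linear W) (aW : adjoint_of ip W W).
Context (S : set H) (sS : subspace S) (cS : gclosed g S).
Context (P : H -> H) (hP : orthogonal_projection g S P).
Local Notation a := (block_a P (J \o W)).
Local Notation b := (block_b P (J \o W)).

Let lP : linear P. Proof. by have [] := orthogonal_projectionP hh hP. Qed.
Let PS x : S (P x). Proof. by have [_ h] := orthogonal_projectionP hh hP. Qed.
Let Pid s : S s -> P s = s.
Proof. by move=> hs; have [_ _ h _] := orthogonal_projectionP hh hP; exact: h. Qed.
Let aP : adjoint_of g P P. Proof. by have [_ _ _] := orthogonal_projectionP hh hP. Qed.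

Lemma block_aE x y : g (a x) y = ip (W (P x)) (P y).
Proof. by rewrite /block_a /= aP (hilbert_ipJ hJ). Qed.

Lemma block_a_adjoint : adjoint_of g a a.
Proof. by move=> x y; rewrite block_aE hg.2 block_aE aW -hip.2. Qed.

Lemma block_a_linear : linear a.
Proof. exact: (adjoint_linear hh block_a_adjoint). Qed.

Lemma block_a_sub x : S (a x).
Proof. exact: PS. Qed.

Lemma block_bE x y : g x (b y) = ip (P x) (W (y - P y)).
Proof. by rewrite /block_b /= -aP (hilbert_ipr hJ). Qed.

Lemma abs_block_sqr absa : is_abs_op g a absa -> is_sqrt_op g (a \o a) absa.
Proof. by move=> [Ts h]; rewrite (adjoint_unique hh h block_a_adjoint). Qed.

Context (absa q : H -> H).
Context (habs : is_abs_op g a absa) (hq : is_sqrt_op g absa q).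

Let pabs : positive_op g absa. Proof. by have [] := abs_block_sqr habs. Qed.
Let pq : positive_op g q. Proof. by have [] := hq. Qed.
Let sabs : adjoint_of g absa absa. Proof. exact: (positive_sym hh pabs). Qed.
Let sq : adjoint_of g q q. Proof. exact: (positive_sym hh pq). Qed.
Let lq : linear q. Proof. exact: pq.1.1. Qed.
Let labs : linear absa. Proof. exact: pabs.1.1. Qed.

Let absE x : absa x = q (q x).
Proof. by have [_ <-] := hq. Qed.
Let abs2 x : absa (absa x) = a (a x).
Proof. by have [_ h] := abs_block_sqr habs; exact: (congr1 (@^~ x) h). Qed.

Lemma nrm_abs x : nrm (absa x) = nrm (a x).
Proof.
rewrite /gnorm -!/(re _ _) (adjoint_reform _ _ sabs) abs2.
by rewrite (adjoint_reform _ _ block_a_adjoint).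
Qed.

Lemma re_abs x y : re (absa x) y = re (q x) (q y).
Proof. by rewrite absE (adjoint_reform _ _ sq). Qed.

(** Splitting [z] along [P] gives [[W s, z] = <q s, w> + <a s, z>] with [q w = b z], and
    [|a s| = |q (q s)|] is at most a multiple of [|q s|]. *)
Lemma weakly_complementable_dominated :
  range b `<=` range q -> dominated ip J S q W.
Proof.
move=> hb z; have [w _ hw] : range q (b z) by apply: hb; exists z.
have [M M0 hM] := bounded_nonneg pq.1.
exists (nrm w + M * nrm z) => s hs.
have -> : rip (W s) z = re (q s) w + re (a s) z.
  rewrite (adjoint_reform _ _ sq) hw /reform block_bE block_aE Pid//.
  by rewrite -aW -!/(rip _ _) (reDr hip) (reNr hip) subrK.
have h1 := re_le hh (q s) w; have h2 := re_le hh (a s) z.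
have h3 : nrm (a s) * nrm z <= M * nrm (q s) * nrm z.
  by rewrite -nrm_abs absE; apply: ler_wpM2r; [exact: nrm_ge0|exact: hM].
by lra.
Qed.

(** Let [w] represent [x |-> <q^3 x, v>] in the closure of the range of [q^3]. Then
    [q^3 (v - w) = 0], hence [q (v - w) = 0] by symmetry, so [v - w] is orthogonal to the range of
    [q] while lying in its closure. *)
Lemma range_cube_dense v : gclosure g (range q) v ->
  gclosure g (range (q \o (q \o q))) v.
Proof.
move=> hv; have l3 : linear (q \o (q \o q)) by do 2 apply: linear_comp => //.
have [||w cw hw] := @riesz_seminorm _ _ g hh setT _
    (fun x => re (q (q (q x))) v) (nrm v) subspaceT l3.
- by move=> r s t _ _; rewrite !lq !(reE hg).
- by move=> s _ /=; rewrite mulrC; exact: (re_le hh).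
have sR := subspace_image lq subspaceT; have scl := subspace_gclosure hh sR.
suff -> : v = w by [].
apply/eqP; rewrite -subr_eq0; apply/eqP; apply: (gclosure_perp_eq0 hh sR).
  apply: (subB scl) => // e e0; have [_ [x _ <-] h] := cw e e0.
  by exists (q (q (q x))) => //; exists (q (q x)).
have q3 : q (q (q (v - w))) = 0.
  apply: (re_eq0 hh) => x; rewrite -!(adjoint_reform _ _ sq) !(reE hg).
  by rewrite (hw x I) subrr.
have q2 : q (q (v - w)) = 0.
  by apply: (hilbert_eq0 hh); rewrite (adjoint_reform _ _ sq) q3 (re0r hg).
have q1 : q (v - w) = 0.
  by apply: (hilbert_eq0 hh); rewrite (adjoint_reform _ _ sq) q2 (re0r hg).
by move=> _ [x _ <-]; rewrite (adjoint_reform _ _ sq) q1 (re0r hg).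
Qed.

Lemma sqrt_abs_commute x : q (a x) = a (q x).
Proof.
have ba := hellinger_toeplitz hh block_a_adjoint.
have h1 : a \o absa = absa \o a.
  by apply: (sqrt_op_commute hh (abs_block_sqr habs)) => //; exact: compA.
have h2 : a \o q = q \o a by exact: (sqrt_op_commute hh hq ba h1).
by rewrite -[q (a x)]/((q \o a) x) -h2.
Qed.

Context (J0 : H -> H) (hJ0 : is_signature ip J0) (q0 U : H -> H).
Local Notation g0 := (hilbert_ip ip J0).
Local Notation hh0 := (hilbert_signature hJ0).
Local Notation hg0 := (hilbert_form hh0).
Local Notation re0 := (reform g0).
Context (lq0 : linear q0) (US : forall x, S (U x)) (UU : forall s, S s -> U (U s) = s).
Context (aU : exists Us, adjoint_of ip U Us).
Context (hq0 : forall s t, S s -> S t -> re0 (q0 s) (q0 t) = rip (W (U s)) t).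

(* With [T = U f], where [absa = a f], the form [re (q s) (q t)] equals
   [re0 (q0 (T s)) (q0 t)]; its comparison with [re0 (q0 s) (q0 t)] is Reid's
   inequality for the symmetrizable operator [T]. *)
Lemma modulus_bound :
  exists2 C : R, 0 <= C & forall s, S s -> nrm (q s) <= C * gnorm g0 (q0 s).
Proof.
(* Since [|absa x| = |a x|], Douglas' lemma applies; both operators being symmetric,
   [a f = absa]. *)
have [|f [fs [hf cf ef]]] := douglas hh subspaceT block_a_linear labs.
  move=> y; exists (nrm y) => s _; rewrite mulrC -nrm_abs; exact: (re_le hh).
have fS y : S (f y).
  apply: cS => e e0; have [z [x _ <-] h] := cf y e e0; exists (a x) => //.
  exact: block_a_sub.
pose T := U \o f.
have bT : bounded_op g T.
  have [Us hUs] := aU; have hU := ip_adjoint_hilbert hJ hUs.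
  apply: (@hellinger_toeplitz _ _ _ hh _ (fs \o (J \o Us \o J))) => x y.
  by rewrite /T /= hU hf.
have [M0 M00 hM0] := bounded_nonneg bT; pose M := M0 + 1.
have M1 : 0 < M by rewrite /M; lra.
have hM x : nrm (T x) <= M * nrm x.
  apply: le_trans (hM0 x) _; apply: ler_wpM2r; first exact: nrm_ge0.
  by rewrite /M; lra.
have TS x : S (T x) by exact: US.
(* [U (T y) = f y] turns the left side into [[W (f y), s] = <absa y, s>]. *)
have key s y : S s -> re0 (q0 s) (q0 (T y)) = re (q s) (q y).
  move=> hs; rewrite (reC hg0) hq0// UU//; rewrite -re_abs /reform -ef// block_aE !Pid//.
  by rewrite aW -!/(rip _ _) (reC hip).
have sym s t : S s -> S t -> re0 (q0 s) (q0 (T t)) = re0 (q0 (T s)) (q0 t).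
  by move=> hs ht; rewrite (reC hg0 (q0 (T s))) !key// (reC hg).
pose N x y := re0 (q0 x) (q0 y).
exists (Num.sqrt M); first exact: sqrtr_ge0.
move=> y hy.
have iS m : S (iter m T y) by case: m => [//|m]; rewrite iterS; exact: TS.
have symi m x : S x -> N (iter m T x) y = N x (iter m T y).
  elim: m x => // m ih x hx; rewrite iterSr ih//.
  by rewrite /N -sym.
pose r k := N (iter (2 ^ k) T y) y.
(* [r k] equals the real part of [[W (U y), T^(2^k) y]], and each factor [T] costs at most [M]. *)
pose D := nrm ((J \o W \o U) y) * nrm y.
have : r 0%N <= M * N y y.
  apply: (@iterated_square_le _ r (N y y) D M) => //.
  - exact: (hilbert_ge0 hh0).
  (* After Cauchy-Schwarz, symmetry moves one power of [T] across the form and doubles the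
     exponent. *)
  - move=> k; rewrite /r; apply: le_trans (semidefinite_CS _ _ hg0 (hilbert_ge0 hh0)) _.
    rewrite -!/(N _ _) le_eqVlt; apply/orP; left; apply/eqP; congr (_ * _).
    by rewrite expnS mul2n -addnn iterD symi.
  move=> k; rewrite /r /N (reC hg0) hq0//.
  rewrite /reform -(hilbert_ipJ hJ) -/(reform g _ _).
  apply: le_trans (re_le hh _ _) _; rewrite /D -mulrA; apply: ler_wpM2l; first exact: nrm_ge0.
  rewrite mulrC; elim: (2 ^ k)%N => [|m ih]; first by rewrite expr0 mul1r.
  rewrite iterS exprS -mulrA; apply: le_trans (hM _) _.
  by apply: ler_wpM2l => //; exact: ltW.
rewrite /r /N expn0 /= (reC hg0) key// => h.
rewrite -(@ler_pXn2r _ 2) ?nnegrE ?mulr_ge0 ?nrm_ge0 ?sqrtr_ge0//.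
have M2 := ltW M1.
by rewrite exprMn (nrm_sqr hh) (nrm_sqr hh0) sqr_sqrtr.
Qed.

(* Characterizes the Schur complement without reference to a signature
   operator other than the fixed [J0]. *)
Definition schur_approx (Z : H -> H) : Prop := forall y z (e : R), 0 < e ->
  exists s, [/\ S s,
    forall t, S t -> `|rip (W (y - s)) t| <= e * gnorm g0 (q0 t)
  & `|rip (Z y) z - rip (W (y - s)) z| <= e].

(** The vector [s = P y + a t] works when [q^3 t] is close to [f y]: against [t'] in [S],
    [W (y - s)] gives [<f y - q^3 t, q t'>], and [modulus_bound] passes from [q] to [q0]. *)
Lemma schur_complement_approx u f fs : polar_decomposition g a absa u ->
  reduced_solution g q b f -> adjoint_of g f fs ->
  schur_approx (J \o (block_c P (J \o W) \- (fs \o u \o f))).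
Proof.
move=> [_ [bu _] _ au] [_ bf _ cf] hfs y z e e0.
have lu := bu.1; have [Mu Mu0 hMu] := bounded_nonneg bu.
have [C C0 hC] := modulus_bound.
(* [K] collects the constants of all the error terms below, which carry the factor [d = e / K]. *)
pose K := C + Mu * nrm (f z) + C * gnorm g0 (q0 (P z)) + 1.
have K1 : 0 <= Mu * nrm (f z) by rewrite mulr_ge0 ?nrm_ge0.
have K2 : 0 <= C * gnorm g0 (q0 (P z)) by rewrite mulr_ge0 ?nrm_ge0.
have K0 : 0 < K by rewrite /K; lra.
pose d := e / K; have d0 : 0 < d by rewrite divr_gt0.
have dK : d * K = e by rewrite /d divfK// gt_eqF.
have dC : d * C <= e by rewrite -dK; apply: ler_wpM2l; [exact: ltW|rewrite /K; lra].
have [|_ [t _ <-] /= ht] := range_cube_dense (v := f y) _ d0.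
  by apply: cf; exists y.
have bE x : b x = q (f x) by rewrite [in LHS]bf.
have aE x : a x = u (absa x) by rewrite [in LHS]au.
set v := q (q (q t)) in ht.
have part t' : S t' -> rip (W (y - (P y + a t))) t' = re (f y - v) (q t').
  move=> ht'; rewrite opprD addrA (linB lW) !(reE hip).
  have -> : rip (W (y - P y)) t' = re (f y) (q t').
    rewrite (reC hg) (adjoint_reform _ _ sq) -bE /reform block_bE (Pid ht').
    by rewrite -!/(rip _ _) (reC hip).
  rewrite (reDl hg) (reNl hg); congr (_ - _); rewrite /v -(adjoint_reform _ _ sq) -!absE abs2.
  by rewrite /reform block_aE (Pid ht') (Pid (block_a_sub t)).
have partS t' : S t' -> `|rip (W (y - (P y + a t))) t'| <= d * C * gnorm g0 (q0 t').
  move=> ht'; rewrite part//; apply: le_trans (abs_re_le hh _ _) _.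
  rewrite -mulrA; apply: ler_pM; rewrite ?nrm_ge0//; [exact: ltW|exact: hC].
exists (P y + a t); split.
- by apply: (subD sS) => //; exact: block_a_sub.
- move=> t' ht'; apply: le_trans (partS t' ht') _.
  by apply: ler_wpM2r => //; exact: nrm_ge0.
have eZ : rip ((J \o (block_c P (J \o W) \- (fs \o u \o f))) y) z =
    rip (W (y - P y)) (z - P z) - re (u (f y)) (f z).
  rewrite -[LHS]/(re (block_c P (J \o W) y - fs (u (f y))) z).
  rewrite (reDl hg) (reNl hg); congr (_ - _); last first.
    by rewrite (reC hg) -(adjoint_reform _ _ hfs) (reC hg).
  rewrite /block_c /= (reDl hg) (reNl hg) (adjoint_reform _ _ aP).
  by rewrite -(reNr hg) -(reDr hg) /reform (hilbert_ipJ hJ).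
(* The last term is [<a t, b z>], rewritten with [b = q f] and
   [q (a t) = a (q t) = u (absa (q t)) = u v]. *)
have eW : rip (W (y - (P y + a t))) z = rip (W (y - (P y + a t))) (P z)
    + (rip (W (y - P y)) (z - P z) - re (u v) (f z)).
  have split_z X : rip X z = rip X (P z) + rip X (z - P z).
    by rewrite -(reDr hip) addrC subrK.
  rewrite split_z; congr (_ + _).
  rewrite opprD addrA (linB lW (y - P y) (a t)) (reDl hip) (reNl hip); congr (_ - _).
  rewrite /v -absE -aE -sqrt_abs_commute (adjoint_reform _ _ sq) -bE.
  by rewrite /reform block_bE (Pid (block_a_sub t)) aW.
rewrite eZ eW.
have h1 := partS _ (PS z).
have h2 : `|re (u (f y - v)) (f z)| <= d * (Mu * nrm (f z)).
  apply: le_trans (abs_re_le hh _ _) _; rewrite mulrA; apply: ler_wpM2r; first exact: nrm_ge0.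
  apply: le_trans (hMu _) _; rewrite mulrC; apply: ler_wpM2r => //; exact: ltW.
move: h2; rewrite (linB lu) !(reE hg) => h2.
have h3 : d * C * gnorm g0 (q0 (P z)) + d * (Mu * nrm (f z)) <= e.
  rewrite -dK -mulrA -mulrDr; apply: ler_wpM2l; [exact: ltW|rewrite /K; lra].
move: h1 h2; rewrite !ler_norml => /andP[? ?] /andP[? ?].
by apply/andP; split; lra.
Qed.

End SchurData.

(** * Schur complements and the decomposition of [S] *)

Section Splitting.
Context {R : realType} {H : lmodType R[i]}.
Context (ip : {hermitian_sym H for Num.conj}).
Context (J : H -> H) (hJ : is_signature ip J).
Local Notation hip := (krein_form ip).
Local Notation rip := (reform ip).
Local Notation g := (hilbert_ip ip J).
Local Notation hh := (hilbert_signature hJ).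
Local Notation hg := (hilbert_form hh).
Local Notation re := (reform g).
Local Notation nrm := (gnorm g).

Context (W : H -> H) (hW : krein_selfadjoint ip W).
Context (S Sp Sm : set H).
Context (sS : subspace S) (sSp : subspace Sp) (sSm : subspace Sm).
Context (hdec : W_orthogonal_direct_sum ip W Sp Sm S).
Context (hWp : W_nonnegative ip W Sp) (hWm : W_nonpositive ip W Sm).
Context (hperp : orthogonal_to g Sp Sm).
Context (P Pp Pm : H -> H) (hP : orthogonal_projection g S P).
Context (hPp : orthogonal_projection g Sp Pp) (hPm : orthogonal_projection g Sm Pm).
Local Notation a := (block_a P (J \o W)).
Local Notation b := (block_b P (J \o W)).

Let lW : linear W. Proof. by have [[]] := hW. Qed.
Let aW : adjoint_of ip W W. Proof. by have [] := hW. Qed.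
Let lP : linear P. Proof. by have [] := orthogonal_projectionP hh hP. Qed.
Let lPp : linear Pp. Proof. by have [] := orthogonal_projectionP hh hPp. Qed.
Let lPm : linear Pm. Proof. by have [] := orthogonal_projectionP hh hPm. Qed.
Let PS x : S (P x). Proof. by have [_ h] := orthogonal_projectionP hh hP. Qed.
Let PpS x : Sp (Pp x). Proof. by have [_ h] := orthogonal_projectionP hh hPp. Qed.
Let PmS x : Sm (Pm x). Proof. by have [_ h] := orthogonal_projectionP hh hPm. Qed.
Let Pid s (hs : S s) : P s = s.
Proof. by have [_ _ h _] := orthogonal_projectionP hh hP; exact: h. Qed.
Let Ppid s (hs : Sp s) : Pp s = s.
Proof. by have [_ _ h _] := orthogonal_projectionP hh hPp; exact: h. Qed.
Let Pmid s (hs : Sm s) : Pm s = s.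
Proof. by have [_ _ h _] := orthogonal_projectionP hh hPm; exact: h. Qed.
Let aP : adjoint_of g P P. Proof. by have [_ _ _] := orthogonal_projectionP hh hP. Qed.
Let aPp : adjoint_of g Pp Pp. Proof. by have [_ _ _] := orthogonal_projectionP hh hPp. Qed.
Let aPm : adjoint_of g Pm Pm. Proof. by have [_ _ _] := orthogonal_projectionP hh hPm. Qed.

Lemma SpS s : Sp s -> S s.
Proof.
move=> hs; have [[<- _] _] := hdec; exists s => //; exists 0; [exact: sub0|].
exact: addr0.
Qed.

Lemma SmS s : Sm s -> S s.
Proof.
move=> hs; have [[<- _] _] := hdec; exists 0; first exact: sub0.
by exists s => //; exact: add0r.
Qed.

Lemma W_cross s t : Sp s -> Sm t -> rip (W s) t = 0.
Proof. by move=> hs ht; have [_ h] := hdec; rewrite /reform h. Qed.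

Lemma W_cross' s t : Sp s -> Sm t -> rip (W t) s = 0.
Proof. by move=> hs ht; rewrite (adjoint_reform _ _ aW) (reC hip) W_cross. Qed.

Lemma Pp_Sm t : Sm t -> Pp t = 0.
Proof.
move=> ht; apply: (hilbert_eq0 hh).
by rewrite (adjoint_reform _ _ aPp) Ppid// (reC hg) /reform hperp.
Qed.

Lemma Pm_Sp s : Sp s -> Pm s = 0.
Proof.
move=> hs; apply: (hilbert_eq0 hh).
by rewrite (adjoint_reform _ _ aPm) Pmid// /reform hperp.
Qed.

Lemma projection_split x : P x = Pp x + Pm x.
Proof.
have e1 : Pp x = Pp (P x).
  apply: (re_inj hh) => y; rewrite -!(adjoint_reform _ _ aPp).
  by rewrite -(adjoint_reform _ _ aP) (Pid (SpS (PpS y))).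
have e2 : Pm x = Pm (P x).
  apply: (re_inj hh) => y; rewrite -!(adjoint_reform _ _ aPm).
  by rewrite -(adjoint_reform _ _ aP) (Pid (SmS (PmS y))).
rewrite e1 e2; have := PS x; have [[<- _] _] := hdec => -[s hs [t ht <-]].
by rewrite (linD lPp) (linD lPm) (Ppid hs) (Pmid ht) (Pp_Sm ht) (Pm_Sp hs) addr0 add0r.
Qed.

(** A sign for [a] on all of [S]: unlike the polar factor it is not cut off on the kernel of [a] in
    [S], so that its square is [P]. *)
Definition sign_op : H -> H := Pp \- Pm.
Local Notation U := sign_op.

Lemma sign_op_sub x : S (U x).
Proof. by apply: (subB sS); [exact: SpS|exact: SmS]. Qed.

Lemma sign_op_linear : linear U.
Proof. exact: linear_sub. Qed.

Lemma sign_opK x : U (U x) = P x.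
Proof.
rewrite /sign_op /= (linB lPp) (linB lPm) (Ppid (PpS x)) (Pmid (PmS x)).
by rewrite (Pp_Sm (PmS x)) (Pm_Sp (PpS x)) subr0 sub0r opprK projection_split.
Qed.

Lemma sign_op_adjoint : adjoint_of g U U.
Proof.
apply: (adjoint_re hg) => [|x y]; first exact: sign_op_linear.
by rewrite /sign_op /= !(reE hg) (adjoint_reform _ _ aPp) (adjoint_reform _ _ aPm).
Qed.

Lemma sign_op_ip_adjoint : exists Us, adjoint_of ip U Us.
Proof. by exists (J \o U \o J); apply: hilbert_adjoint_ip => //; exact: sign_op_adjoint. Qed.

Lemma sign_op_projl x : P (U x) = U x.
Proof. exact/Pid/sign_op_sub. Qed.

Lemma sign_op_projr x : U (P x) = U x.
Proof. by rewrite -sign_opK sign_opK sign_op_projl. Qed.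

Lemma sign_form x y :
  rip (W (U x)) (P y) = rip (W (Pp x)) (Pp y) - rip (W (Pm x)) (Pm y).
Proof.
rewrite projection_split /sign_op /= (linB lW) !(reE hip).
by rewrite (W_cross (PpS x) (PmS y)) (W_cross' (PpS y) (PmS x)); lra.
Qed.

Definition abs_block : H -> H := a \o U.

Lemma re_abs_block x y : re (abs_block x) y = rip (W (U x)) (P y).
Proof. by rewrite /reform /abs_block /= (block_aE hJ W hP) sign_op_projl. Qed.

Lemma abs_block_sym x y : re (abs_block x) y = re x (abs_block y).
Proof.
rewrite (reC hg x) !re_abs_block !sign_form; congr (_ - _).
  by rewrite (adjoint_reform _ _ aW) (reC hip).
by rewrite (adjoint_reform _ _ aW) (reC hip).
Qed.

Let aa : adjoint_of g a a. Proof. exact: (block_a_adjoint hJ aW hP). Qed.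
Let la : linear a. Proof. exact: (adjoint_linear hh aa). Qed.

Lemma abs_block_positive : positive_op g abs_block.
Proof.
apply: (symmetric_positive hh); [|exact: abs_block_sym|].
  by apply: linear_comp => //; exact: sign_op_linear.
move=> x; rewrite re_abs_block sign_form subr_ge0.
have h1 := hWp (PpS x); have h2 := hWm (PmS x).
move: h1 h2; rewrite !lecE => /andP[_ h1] /andP[_ h2].
exact: le_trans h2 h1.
Qed.

(** Both factors and their product are symmetric, so they commute. *)
Lemma sign_op_block x : U (a x) = a (U x).
Proof.
apply: (re_inj hh) => y; rewrite -(adjoint_reform _ _ sign_op_adjoint).
rewrite -(adjoint_reform _ _ aa) -[a (U y)]/(abs_block y).
exact: abs_block_sym.
Qed.

Lemma block_a_proj x : a (P x) = a x.
Proof. by rewrite /block_a /= (Pid (PS x)). Qed.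

Lemma abs_block_is_abs : is_abs_op g a abs_block.
Proof.
exists a => //; split; first exact: abs_block_positive.
apply/funext => x /=; rewrite /abs_block /= sign_op_block sign_opK.
by rewrite block_a_proj.
Qed.

Context (q : H -> H) (hq : is_sqrt_op g abs_block q).

Let pq : positive_op g q. Proof. by have [] := hq. Qed.
Let sq : adjoint_of g q q. Proof. exact: (positive_sym hh pq). Qed.
Let lq : linear q. Proof. exact: pq.1.1. Qed.

Lemma sqrt_form s t : S s -> S t -> re (q s) (q t) = rip (W (U s)) t.
Proof.
move=> hs ht; rewrite -(adjoint_reform _ _ sq) -[q (q s)]/((q \o q) s).
by have [_ ->] := hq; rewrite re_abs_block Pid.
Qed.

Lemma sqrt_form_p s t : Sp s -> Sp t -> re (q s) (q t) = rip (W s) t.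
Proof.
move=> hs ht; rewrite sqrt_form; [|exact: SpS|exact: SpS].
by rewrite /sign_op /= (Ppid hs) (Pm_Sp hs) subr0.
Qed.

Lemma sqrt_form_m s t : Sm s -> Sm t -> re (q s) (q t) = - rip (W s) t.
Proof.
move=> hs ht; rewrite sqrt_form; [|exact: SmS|exact: SmS].
by rewrite /sign_op /= (Pmid hs) (Pp_Sm hs) sub0r (linN lW) (reNl hip).
Qed.

Lemma sqrt_form_split x : re (q x) (q x) =
  re (q (Pp x)) (q (Pp x)) + re (q (Pm x)) (q (Pm x)).
Proof.
rewrite -(adjoint_reform _ _ sq) -[q (q x)]/((q \o q) x); have [_ ->] := hq.
by rewrite re_abs_block sign_form sqrt_form_p// sqrt_form_m.
Qed.

Lemma sqrt_Pp_le x : nrm (q (Pp x)) <= nrm (q x).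
Proof.
rewrite -(@ler_pXn2r _ 2) ?nnegrE ?nrm_ge0// !(nrm_sqr hh) (sqrt_form_split x).
by rewrite lerDl; exact: (hilbert_ge0 hh).
Qed.

Lemma sqrt_Pm_le x : nrm (q (Pm x)) <= nrm (q x).
Proof.
rewrite -(@ler_pXn2r _ 2) ?nnegrE ?nrm_ge0// !(nrm_sqr hh) (sqrt_form_split x).
by rewrite lerDr; exact: (hilbert_ge0 hh).
Qed.

Lemma sqrt_proj x : nrm (q (P x)) = nrm (q x).
Proof.
rewrite /gnorm -!/(re _ _); congr Num.sqrt.
rewrite -!(adjoint_reform _ _ sq) -![q (q _)]/((q \o q) _); have [_ ->] := hq.
by rewrite !re_abs_block sign_op_projr (Pid (PS x)).
Qed.

Lemma dominated_p : dominated ip J S q W -> dominated ip J Sp q W.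
Proof. by move=> h y; have [C hC] := h y; exists C => s /SpS; exact: hC. Qed.

Lemma dominated_m : dominated ip J S q W -> dominated ip J Sm q (fun x => - W x).
Proof.
move=> h y; have [C hC] := h (- y); exists C => s /SmS /hC.
by rewrite (reNl hip) (reNr hip).
Qed.

(** Neither [Pp] nor [Pm] increases [|q s|], so the bounds on the two summands add up. *)
Lemma dominated_join : dominated ip J Sp q W ->
  dominated ip J Sm q (fun x => - W x) -> dominated ip J S q W.
Proof.
move=> h1 h2 y; have [C1 hC1] := h1 y; have [C2 hC2] := h2 (- y).
exists (`|C1| + `|C2|) => s hs.
rewrite -{1}(Pid hs) projection_split (linD lW) (reDl hip) mulrDl.
have bound C x t : x <= C * nrm (q t) -> nrm (q t) <= nrm (q s) -> x <= `|C| * nrm (q s).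
  move=> h h'; apply: le_trans h _; apply: (@le_trans _ _ (`|C| * nrm (q t))).
    by apply: ler_wpM2r; [exact: nrm_ge0|exact: ler_norm].
  exact: ler_wpM2l.
apply: lerD; first by apply: bound (hC1 _ (PpS s)) (sqrt_Pp_le s).
apply: bound (sqrt_Pm_le s).
by have := hC2 _ (PmS s); rewrite (reNl hip) (reNr hip) opprK.
Qed.

(** * The common value of the two nested extrema *)

Section Extremum.
Context (f1 f2 Phi1 Phi2 : H -> H).
Context (rf1 : reduced_map ip J Sp q W f1).
Context (rf2 : reduced_map ip J Sm q (fun x => - W x) f2).
Context (gr1 : gram ip J f1 Phi1) (gr2 : gram ip J f2 Phi2).

Definition extremum : H -> H := fun x => W x - Phi1 x + Phi2 x.

Let f1_re s y (hs : Sp s) : re (q s) (f1 y) = rip (W s) y.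
Proof. by have [_ _ h] := rf1; rewrite /reform h. Qed.

Let f2_re s y (hs : Sm s) : re (q s) (f2 y) = - rip (W s) y.
Proof. by have [_ _ h] := rf2; rewrite {1}/reform h// -/(rip _ _) (reNl hip). Qed.

Let Phi1_re x y : rip (Phi1 x) y = re (f1 x) (f1 y).
Proof. by rewrite /reform gr1.2. Qed.

Let Phi2_re x y : rip (Phi2 x) y = re (f2 x) (f2 y).
Proof. by rewrite /reform gr2.2. Qed.

(** [W]-orthogonality makes the represented functional vanish on [Sp]; this decouples the inner and
    the outer extremum. *)
Lemma f1_Sm t : Sm t -> f1 t = 0.
Proof. by move=> ht; apply: (reduced_map_eq0 hJ sSp lq rf1) => s hs; exact: W_cross. Qed.

Lemma f2_Sp s : Sp s -> f2 s = 0.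
Proof.
move=> hs; apply: (reduced_map_eq0 hJ sSm lq rf2) => t ht.
by rewrite (reNl hip) (W_cross' hs ht) oppr0.
Qed.

(** The inner maximum is [W \- Phi1]. Its negative [V] agrees with [- W] on [Sm], where [Phi1]
    vanishes, so [f2] is still the reduced map; the maximum for [V] is negated into the outer
    minimum. *)
Lemma extremum_min_max : is_min_max ip W Sp Sm extremum.
Proof.
exists (W \- Phi1); first exact: (max_Nminus hJ sSp lq hW sqrt_form_p rf1 gr1).
pose V x := - (W \- Phi1) x.
have sV : krein_selfadjoint ip V by exact: krein_opp (krein_sub hW gr1.1).
have eV t y : Sm t -> ip (V t) y = ip (- W t) y.
  move=> ht; have e0 : ip (Phi1 t) y = 0 by rewrite gr1.2 f1_Sm// (form0l hg).
  rewrite /V /= opprB (formDl hip) e0 add0r; reflexivity.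
have rV : reduced_map ip J Sm q V f2.
  by have [h1 h2 h3] := rf2; split=> // s y hs; rewrite h3// eV.
have qV s t : Sm s -> Sm t -> re (q s) (q t) = rip (V s) t.
  by move=> hs ht; rewrite sqrt_form_m// /reform eV// -!/(rip _ _) (reNl hip).
have h := max_Nminus hJ sSm lq sV qV rV gr2.
have := min_Nplus h.
have -> : (fun x => - V x) = W \- Phi1 by apply/funext => x; rewrite /V opprK.
have -> // : (fun x => - (V \- Phi2) x) = extremum.
by apply/funext => x; rewrite /V /extremum /= opprD !opprK.
Qed.

Lemma extremum_max_min : is_max_min ip W Sp Sm extremum.
Proof.
pose V := fun x => - W x.
have sV : krein_selfadjoint ip V by exact: krein_opp hW.
have qV s t : Sm s -> Sm t -> re (q s) (q t) = rip (V s) t.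
  by move=> hs ht; rewrite sqrt_form_m// /V (reNl hip).
have h := max_Nminus hJ sSm lq sV qV rf2 gr2.
have := min_Nplus h.
have -> : (fun x => - V x) = W by apply/funext => x; rewrite /V opprK.
set Y := fun x => _ => hY; exists Y => //.
have sY : krein_selfadjoint ip Y by exact: krein_opp (krein_sub sV gr2.1).
have eY s y : Sp s -> ip (Y s) y = ip (W s) y.
  move=> hs; have e0 : ip (Phi2 s) y = 0 by rewrite gr2.2 f2_Sp// (form0l hg).
  by rewrite /Y /V /= opprD !opprK (formDl hip) e0 addr0.
have rY : reduced_map ip J Sp q Y f1.
  by have [h1 h2 h3] := rf1; split=> // s y hs; rewrite h3// eY.
have qY s t : Sp s -> Sp t -> re (q s) (q t) = rip (Y s) t.
  by move=> hs ht; rewrite sqrt_form_p// /reform eY.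
have := max_Nminus hJ sSp lq sY qY rY gr1.
have -> // : Y \- Phi1 = extremum.
by apply/funext => x; rewrite /Y /V /extremum /= opprD !opprK addrAC.
Qed.

(** The approximating vector is [s1 + s2], with [q s1] close to [f1 y] and [q s2] close to
    [f2 y]. *)
Lemma extremum_approx : schur_approx ip W S J q extremum.
Proof.
(* The 2 covers the two errors measured by [|q t|], the norms those paired with [f1 z] and
   [f2 z]. *)
move=> y z e e0; pose K := 2 + nrm (f1 z) + nrm (f2 z).
have n1 := nrm_ge0 g (f1 z); have n2 := nrm_ge0 g (f2 z).
have K0 : 0 < K by rewrite /K; lra.
pose d := e / K; have d0 : 0 < d by rewrite divr_gt0.
have dK : d * K = e by rewrite /d divfK// gt_eqF.
have [_ c1 _] := rf1; have [_ c2 _] := rf2.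
have [_ [s1 hs1 <-] h1] := c1 y d d0; have [_ [s2 hs2 <-] h2] := c2 y d d0.
have bound x t : nrm x < d -> `|re x t| <= d * nrm t.
  move=> hx; apply: le_trans (abs_re_le hh _ _) _.
  by apply: ler_wpM2r; [exact: nrm_ge0|exact: ltW].
exists (s1 + s2); split; first by apply: (subD sS); [exact: SpS|exact: SmS].
  move=> t ht.
  have -> : rip (W (y - (s1 + s2))) t =
      re (f1 y - q s1) (q (Pp t)) - re (f2 y - q s2) (q (Pm t)).
    rewrite -{1}(Pid ht) projection_split (linB lW) (linD lW) !(reE hip).
    rewrite (W_cross hs1 (PmS t)) (W_cross' (PpS t) hs2) !(reE hg).
    rewrite (reC hg (f1 y)) (reC hg (f2 y)) f1_re// f2_re//.
    rewrite sqrt_form_p// sqrt_form_m//.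
    rewrite (adjoint_reform (Pp t) y aW) (reC hip (Pp t)).
    by rewrite (adjoint_reform (Pm t) y aW) (reC hip (Pm t)); lra.
  have b1 := bound _ (q (Pp t)) h1; have b2 := bound _ (q (Pm t)) h2.
  have e1 : 2 * d <= e by rewrite -dK mulrC ler_pM2l// /K; lra.
  have b3 : d * nrm (q (Pp t)) <= d * nrm (q t).
    by rewrite ler_pM2l//; exact: sqrt_Pp_le.
  have b4 : d * nrm (q (Pm t)) <= d * nrm (q t).
    by rewrite ler_pM2l//; exact: sqrt_Pm_le.
  have b5 : 2 * d * nrm (q t) <= e * nrm (q t).
    by apply: ler_wpM2r => //; exact: nrm_ge0.
  by move: b1 b2; rewrite !ler_norml => /andP[? ?] /andP[? ?]; apply/andP; split; lra.
have -> : rip (extremum y) z - rip (W (y - (s1 + s2))) z =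
    re (f2 y - q s2) (f2 z) - re (f1 y - q s1) (f1 z).
  rewrite /extremum (linB lW) (linD lW) !(reE hip) !(reE hg) Phi1_re Phi2_re.
  by rewrite f1_re// f2_re//; lra.
have b1 := bound _ (f1 z) h1; have b2 := bound _ (f2 z) h2.
have e1 : d * nrm (f1 z) + d * nrm (f2 z) <= e.
  by rewrite -dK /K !mulrDr; lra.
by move: b1 b2; rewrite !ler_norml => /andP[? ?] /andP[? ?]; apply/andP; split; lra.
Qed.

End Extremum.

(** Let [d] be the difference of the two approximating vectors. Testing [W d] against [U d] gives
    [|q d|^2 <= 2 e |q d|], and domination at [z] makes [[W d, z]] small in turn. *)
Lemma schur_approx_unique Z Z' : dominated ip J S q W ->
  schur_approx ip W S J q Z -> schur_approx ip W S J q Z' -> Z = Z'.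
Proof.
move=> hd hZ hZ'; suff le V V' y z : schur_approx ip W S J q V ->
    schur_approx ip W S J q V' -> rip (V y) z - rip (V' y) z <= 0.
  apply/funext => y; apply: (krein_inj hJ) => z; apply/eqP; rewrite eq_le.
  by apply/andP; split; rewrite -subr_le0; exact: le.
move=> hV hV'; have [C hC] := hd z.
apply: (@le0_small _ _ (2 + 2 * `|C|)) => e e0.
have [s [hs hs1 hs2]] := hV y z e e0; have [t [ht ht1 ht2]] := hV' y z e e0.
pose d := t - s; have hdS : S d by exact: (subB sS).
have eW u : rip (W d) u = rip (W (y - s)) u - rip (W (y - t)) u.
  by rewrite /d !(linB lW) !(reE hip); lra.
have small u : S u -> rip (W d) u <= 2 * e * nrm (q u).
  move=> hu; rewrite eW; have := hs1 u hu; have := ht1 u hu.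
  by rewrite !ler_norml => /andP[? ?] /andP[? ?]; lra.
have UUd : U (U d) = d by rewrite sign_opK Pid.
have e1 : rip (W d) (U d) = re (q d) (q d).
  by rewrite sqrt_form// (adjoint_reform _ _ aW) (reC hip).
have e2 : nrm (q (U d)) = nrm (q d).
  rewrite /gnorm -!/(re _ _) sqrt_form; try exact: sign_op_sub.
  by rewrite UUd e1.
have nd : nrm (q d) <= 2 * e.
  have := small _ (sign_op_sub d); rewrite e1 e2 -(nrm_sqr hh) expr2.
  have [->|n0] := eqVneq (nrm (q d)) 0; first by move=> _; lra.
  by rewrite ler_pM2r// lt_neqAle eq_sym n0 nrm_ge0.
have h1 : rip (W d) z <= `|C| * (2 * e).
  apply: le_trans (hC d hdS) _; apply: (@le_trans _ _ (`|C| * nrm (q d))).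
    by apply: ler_wpM2r; [exact: nrm_ge0|exact: ler_norm].
  exact: ler_wpM2l.
move: h1 hs2 ht2; rewrite eW !ler_norml => h1 /andP[? ?] /andP[? ?].
by lra.
Qed.

Lemma schur_complement_exists : dominated ip J S q W ->
  exists Z, is_schur_complement g (J \o W) S Z.
Proof.
(* [T] is the adjoint of [b], so its Douglas factor solves [b = q f]. *)
move=> hd; pose T x := J (W (P x)) - P (J (W (P x))).
have lJ := signature_linear hJ.
have lT : linear T.
  apply: (linear_sub (T1 := J \o W \o P) (T2 := P \o (J \o W \o P))).
    by do 2 apply: linear_comp => //.
  by apply: linear_comp => //; do 2 apply: linear_comp => //.
have aJW := krein_adjoint_op hJ aW.
have Tb x y : g (T x) y = g x (b y).
  apply: (form_realP hg); last rewrite -(linZ lT);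
    rewrite /T /block_b /= !(reE hg) -!(adjoint_reform _ _ aP);
    by rewrite -(adjoint_reform _ _ aJW) !(reE hg) /= -!(adjoint_reform _ _ aP).
have [|f [fs [hf cf ef]]] := douglas hh subspaceT lq lT.
  move=> y; have [C hC] := hd (y - P y); exists C => s _.
  rewrite /reform Tb (block_bE hJ W hP) -aW -/(reform ip _ _) -sqrt_proj.
  exact: hC.
have qf y : q (f y) = b y.
  by apply: (form_inj hh) => x; rewrite -(positive_sym hh pq) ef// Tb.
have sa := subspace_image la subspaceT.
have [E hE] := projection_exists hh (subspace_gclosure hh sa)
  (@gclosed_gclosure _ _ _ hh (range a)).
have [lE ES Eid aE] := orthogonal_projectionP hh hE.
have clS x : gclosure g (range a) x -> P x = x.
  move=> hx; have h1 : re x (x - P x) = 0.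
    apply: (gclosure_perp hh _ hx) => _ [v _ <-].
    rewrite -(Pid (block_a_sub hJ W hP v)) (adjoint_reform _ _ aP) (linB lP).
    by rewrite (Pid (PS x)) subrr (re0r hg).
  have h2 : re (P x) (x - P x) = 0.
    by rewrite (adjoint_reform _ _ aP) (linB lP) (Pid (PS x)) subrr (re0r hg).
  apply/eqP; rewrite eq_sym -subr_eq0; apply/eqP; apply: (hilbert_eq0 hh).
  by rewrite (reDl hg) (reNl hg) h1 h2 subrr.
have Ea x : E (a x) = a x by apply: Eid; apply: (gclosure_sub hh); exists x.
(* The polar factor must vanish exactly on the kernel of [a], so [U] is cut down to the closure of
   the range of [a]. *)
pose u := U \o E.
have UUE x : U (U (E x)) = E x by rewrite sign_opK clS.
have E0 x : a x = 0 -> E x = 0.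
  move=> ax; apply: (gclosure_perp_eq0 hh sa) => // _ [v _ <-].
  by rewrite -(adjoint_reform _ _ aE) Ea (adjoint_reform _ _ aa) ax (re0r hg).
have u0 : nullspace u = nullspace a.
  apply/seteqP; split=> x; rewrite /nullspace /u /= => h; last first.
    by rewrite (E0 x h) (lin0 sign_op_linear).
  have Ex : E x = 0 by rewrite -UUE h (lin0 sign_op_linear).
  apply: (re_eq0 hh) => v; rewrite -(adjoint_reform _ _ aa) -Ea.
  by rewrite (adjoint_reform _ _ aE) Ex (re0r hg).
have pol : polar_decomposition g a abs_block u.
  split=> //; first exact: abs_block_is_abs; last first.
    apply/funext => x; rewrite /u /abs_block /= Ea sign_op_block sign_opK.
    by rewrite block_a_proj.
  split.
    apply: (@hellinger_toeplitz _ _ _ hh _ (E \o U)) => x y.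
    by rewrite /u /= sign_op_adjoint aE.
  move=> x hx; have Ex : E x = x.
    have EE : E (x - E x) = 0 by rewrite (linB lE) (Eid _ (ES x)) subrr.
    have h1 : re x (x - E x) = 0.
      by rewrite /reform hx// /nullspace /u /= EE (lin0 sign_op_linear).
    have h2 : re (E x) (x - E x) = 0 by rewrite (adjoint_reform _ _ aE) EE (re0r hg).
    apply/eqP; rewrite eq_sym -subr_eq0; apply/eqP; apply: (hilbert_eq0 hh).
    by rewrite (reDl hg) (reNl hg) h1 h2 subrr.
  rewrite /gnorm -!/(re _ _) /u /=; congr Num.sqrt.
  by rewrite (adjoint_reform _ _ sign_op_adjoint) UUE !Ex.
have red : reduced_solution g q b f.
  split; [exact: (hellinger_toeplitz hh hf)|by apply/funext => y; rewrite /= qf| |].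
    apply/seteqP; split=> y; rewrite /nullspace /= => h.
      by rewrite -qf h (lin0 lq).
    apply: (gclosure_perp_eq0 hh (subspace_image lq subspaceT)) => // _ [x _ <-].
    by rewrite (adjoint_reform _ _ sq) qf h (re0r hg).
  by move=> _ [y _ <-]; exact: cf.
have hb : range b `<=` range q.
  by move=> _ [y _ <-]; exists (f y) => //; exact: qf.
exists (block_c P (J \o W) \- (fs \o u \o f)); split.
  by exists P, abs_block, q; split=> //; exact: abs_block_is_abs.
by exists P, abs_block, q, u, f, fs.
Qed.

(** * Complementability and extrema compared through domination by [q] *)

Section Conclusion.
Context (hS : krein_closed_subspace ip S).

Let Us := sign_op_ip_adjoint.
Let UU s (hs : S s) : U (U s) = s. Proof. by rewrite sign_opK Pid. Qed.

(** The signature operator [J'] of the hypothesis may differ from [J]; [modulus_bound] replaces its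
    [q'] by [q]. *)
Lemma weakly_complementable_dominates :
  krein_weakly_complementable ip W S -> dominated ip J S q W.
Proof.
move=> [J' hJ' [P' [absa' [q' [hP' habs' hq' hb]]]]] y.
have [C1 hC1] := weakly_complementable_dominated hJ' aW hP' habs' hq' hb y.
have [C C0 hC] := modulus_bound hJ' aW (hS.2 _ hJ') hP' habs' hq' hJ
  sign_op_sub UU Us sqrt_form.
exists (`|C1| * C) => s hs; apply: le_trans (hC1 s hs) _; rewrite -mulrA.
apply: (@le_trans _ _ (`|C1| * gnorm (hilbert_ip ip J') (q' s))).
  by apply: ler_wpM2r; [exact: nrm_ge0|exact: ler_norm].
by apply: ler_wpM2l => //; exact: hC.
Qed.

(** Each inner extremum is a one-sided bound of [W] that yields domination on its own summand. *)
Lemma extrema_dominated : (exists Z, is_min_max ip W Sp Sm Z) ->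
  (exists Z, is_max_min ip W Sp Sm Z) -> dominated ip J S q W.
Proof.
move=> [Z [Y [hY _] _]] [Z' [Y' [hY' _] _]]; apply: dominated_join.
  by apply: (dominated_Nminus hJ lq hW _ hY) => s hs; rewrite sqrt_form_p.
apply: (dominated_Nminus hJ lq (krein_opp hW) _ (Nminus_opp hY')) => s hs.
by rewrite sqrt_form_m// (reNl hip).
Qed.

Lemma krein_schur_approx Z : is_krein_schur_complement ip W S Z ->
  schur_approx ip W S J q Z.
Proof.
move=> [J' hJ' [B [_ [P' [absa' [q' [u [f [fs [hP' [pol hq'] red hfs ->]]]]]]]] ->]].
have habs' : is_abs_op (hilbert_ip ip J') (block_a P' (J' \o W)) absa' by have [] := pol.
exact: (schur_complement_approx hJ' lW aW sS (hS.2 _ hJ') hP' habs' hq' hJ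
  sign_op_sub UU Us sqrt_form pol red hfs).
Qed.

(** Every Schur complement, whatever its signature operator, satisfies [schur_approx], as does
    [extremum]; uniqueness identifies them. *)
Lemma dominated_extremum : dominated ip J S q W -> krein_weakly_complementable ip W S /\
  exists Z, [/\ unique (is_krein_schur_complement ip W S) Z,
    is_min_max ip W Sp Sm Z & is_max_min ip W Sp Sm Z].
Proof.
move=> hd; have [B hB] := schur_complement_exists hd.
split; first by exists J => //; exact: hB.1.
have hZ : is_krein_schur_complement ip W S (J \o B) by exists J => //; exists B.
have [f1 rf1] := reduced_map_exists hJ sSp lq lW (dominated_p hd).
have [f2 rf2] := reduced_map_exists hJ sSm lq (krein_opp hW).1.1 (dominated_m hd).
have [Phi1 gr1] := gram_exists hJ rf1; have [Phi2 gr2] := gram_exists hJ rf2.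
have eZ Z : is_krein_schur_complement ip W S Z -> extremum Phi1 Phi2 = Z.
  move=> /krein_schur_approx; apply: (schur_approx_unique hd).
  exact: (extremum_approx rf1 rf2 gr1 gr2).
exists (extremum Phi1 Phi2); split.
- by split; [rewrite (eZ _ hZ)|exact: eZ].
- exact: (extremum_min_max rf1 rf2 gr1 gr2).
- exact: (extremum_max_min rf1 rf2 gr1 gr2).
Qed.

End Conclusion.

End Splitting.

Theorem theorem4p9 (R : realType) (H : lmodType R[i])
    (ip : {hermitian_sym H for Num.conj}) (hH : krein_space ip)
    (W : H -> H) (hW : krein_selfadjoint ip W)
    (S : set H) (hS : krein_closed_subspace ip S)
    (J : H -> H) (hJ : is_signature ip J)
    (Sp Sm : set H)
    (hSp : krein_closed_subspace ip Sp) (hSm : krein_closed_subspace ip Sm)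
    (hdec : W_orthogonal_direct_sum ip W Sp Sm S)
    (hWp : W_nonnegative ip W Sp) (hWm : W_nonpositive ip W Sm)
    (hperp : orthogonal_to (hilbert_ip ip J) Sp Sm) :
  (krein_weakly_complementable ip W S <->
     (exists Z, is_min_max ip W Sp Sm Z) /\
     (exists Z, is_max_min ip W Sp Sm Z)) /\
  (krein_weakly_complementable ip W S ->
     exists Z, [/\ unique (is_krein_schur_complement ip W S) Z,
                   is_min_max ip W Sp Sm Z & is_max_min ip W Sp Sm Z]).
Proof.
have hh := hilbert_signature hJ.
have [P hP] := projection_exists hh hS.1 (hS.2 J hJ).
have [Pp hPp] := projection_exists hh hSp.1 (hSp.2 J hJ).
have [Pm hPm] := projection_exists hh hSm.1 (hSm.2 J hJ).
(* This root of the modulus for the given [J] is fixed; domination of [W] on [S] by [q] is the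
   condition through which both implications pass. *)
have [q hq _] := sqrt_op_exists hh
  (abs_block_positive hJ hW hS.1 hSp.1 hSm.1 hdec hWp hWm hperp hP hPp hPm).
have extr := dominated_extremum hJ hW hS.1 hSp.1 hSm.1 hdec hWp hWm hperp hP hPp hPm hq hS.
have dom := weakly_complementable_dominates hJ hW hS.1 hSp.1 hSm.1 hdec hperp hP hPp hPm hq hS.
have dom' := extrema_dominated hJ hW hS.1 hSp.1 hSm.1 hdec hperp hP hPp hPm hq.
split; last by move=> /dom /extr[].
split=> [/dom /extr[_ [Z [_ h1 h2]]]|[h1 h2]]; first by split; exists Z.
by have [] := extr (dom' h1 h2).
Qed.
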